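(* (Horizontal Collapsing Property) Let $K$ be a union of finitely many disjoint simple smoothly closed (possibly linked or knotted) curves in $\mathbf{R}^{n}$ and let $\mu:K\to(0,\infty)$ be of class $C^3$. Assume that $\exp^{\mu}(q_{1},r_{1}v_{1})=\exp^{\mu}(q_{2},r_{2}v_{2})=p_{0}$ for some $0\le r_{1},r_{2}<UR(K,\mu)$, $q_1,q_2\in K$ and unit normal vectors $v_{i}\in NK_{q_{i}}$ with $(q_{1},r_{1}v_{1})\neq(q_{2},r_{2}v_{2})$. Then: (i) $q_{1}$ and $q_{2}$ belong to the same component of $K$, which is denoted by $K_{1}$. (ii) Let $\gamma:\mathbf{R}\to K_{1}\subset\mathbf{R}^{n}$ be a unit speed parametrization of $K_{1}$ such that $\gamma(s+L)=\gamma(s)$ where $L$ is the length of $K_{1}$, let $N_{\gamma}(s)$ denote the principal normal of $\gamma$, and let $q_{i}=\gamma(s_{i})$ for $i=1,2$ with $0\leq s_{1}<s_{2}<L$ (after interchanging the indices if necessary). Then $r_{1}=r_{2}$, $v_{i}=N_{\gamma}(s_{i})$ for $i=1,2$, and $\exp^{\mu}(\gamma(s),r_{1}N_{\gamma}(s))=p_{0}$ for all $s\in I$, where $I=[s_{1},s_{2}]$ or $I=[s_{2}-L,s_{1}]$. (iii) On the interval $I$, the curvature $\kappa$ of $\gamma$ is a positive constant and all of the following hold: $$(\mu')^{2}-\mu\mu''=\frac{1}{r_{1}^{2}},\qquad \gamma'''+\kappa^{2}\gamma'=0,\qquad \mu=\frac{2}{\kappa r_{1}}\cos\left(\frac{\kappa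 s}{2}+a\right)\text{ for some }a\in\mathbf{R}.$$ Therefore, horizontal collapsing occurs in a unique way, only above arcs of circles of curvature $\kappa$ and with this specific $\mu$. Moreover $\gamma(I)\neq K_{1}$, even if $I$ is chosen to be a maximal interval such that $\kappa(s)>0$ and $\exp^{\mu}(\gamma(s),r_{1}N_{\gamma}(s))=p_{0}$ for all $s\in I$.
   Context: Setting. $K\subset\mathbf{R}^n$ is a compact $1$-dimensional submanifold with finitely many components. Parametrizations $\gamma$ of $K$ are with respect to arclength $s$; one writes $\mu(s)=\mu(\gamma(s))$, primes denote $d/ds$, $\kappa(s)=\|\gamma''(s)\|$ is the curvature, and $N_\gamma(s)=\gamma''(s)/\kappa(s)$ is the principal normal (defined where $\kappa(s)>0$). $NK_q$ is the set of vectors normal to $K$ at $q$. The intrinsic gradient of $\mu$ is $\mathrm{grad}\,\mu(\gamma(s))=\mu'(s)\gamma'(s)$. Exponential map. $W=\{(q,w): q\in K,\ w\in NK_q,\ \|w\|\le \|\mathrm{grad}\,\mu(q)\|^{-1}\text{ when }\mathrm{grad}\,\mu(q)\ne0\}$ and $\exp^\mu:W\to\mathbf{R}^n$, $$\exp^{\mu}(q,w)=q-\mu(q)\|w\|^{2}\,\mathrm{grad}\,\mu(q)+\mu(q)\sqrt{1-\|\mathrm{grad}\,\mu(q)\|^{2}\|w\|^{2}}\;w .$$ Double critical self distance. A pair $(q_1,q_2)\in K\times K$ with $q_1\ne q_2$ is a double critical pair for $(K,\mu)$ if it is a critical point of $\Sigma:K\times K\to\mathbf{R}$, $\Sigma(x,y)=\|x-y\|^2(\mu(x)+\mu(y))^{-2}$.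 Then $\tfrac12 DCSD(K,\mu)$ is the minimum of $\frac{\|q_1-q_2\|}{\mu(q_1)+\mu(q_2)}$ over all double critical pairs $(q_1,q_2)$. Upper radius. Put $\Lambda=\frac12(\mu^2)''+\frac12\kappa^2\mu^2+\kappa\mu\sqrt{\mu(\mu''+\frac14\kappa^2\mu)}$ where $\mu''+\frac14\kappa^2\mu\ge0$. For $K$ connected, $$FocRad^{-}(K,\mu)=\Big(\max\big[\sup\{\Lambda(s):(\mu''+\tfrac14\kappa^2\mu)(s)>0\},\ \max_s|\mu'(s)|^2\big]\Big)^{-1/2};$$ for several components one takes the minimum over the components. $UR(K,\mu)=\min(\tfrac12DCSD(K,\mu),FocRad^{-}(K,\mu))$. *)

(* Defs.v *)
From HB Require Import structures.
From mathcomp Require Import all_boot all_order all_algebra.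
From mathcomp Require Import all_classical all_reals all_analysis.
Set Implicit Arguments.
Unset Strict Implicit.
Unset Printing Implicit Defensive.
Import Order.TTheory GRing.Theory Num.Theory.
Import numFieldNormedType.Exports.
Local Open Scope ring_scope.
Local Open Scope classical_set_scope.

(* The norm that the library puts on 'rV[R]_n is the sup norm: it induces the
   right topology and derivatives, but lengths below are Euclidean. *)
Definition dot (R : realType) (n : nat) (u v : 'rV[R]_n) : R :=
  \sum_(i < n) u 0 i * v 0 i.

Definition enorm (R : realType) (n : nat) (u : 'rV[R]_n) : R :=
  Num.sqrt (dot u u).

Definition class_C (R : realType) (V : normedModType R) (k : nat)
    (f : R -> V) : Prop :=
  (forall j : nat, (j < k)%N -> forall t : R, derivable (f^`(j)) t 1) /\
  continuous (f^`(k)).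

Definition smooth (R : realType) (V : normedModType R) (f : R -> V) : Prop :=
  forall k : nat, class_C k f.

(* Unit speed parametrization of a simple smoothly closed curve. Injectivity on
   [0, L[ makes L the length of the curve, not a multiple of it. *)
Definition closed_curve (R : realType) (n : nat) (gamma : R -> 'rV[R]_n)
    (L : R) : Prop :=
  [/\ 0 < L,
      smooth gamma,
      forall s : R, enorm (gamma^`()%classic s) = 1,
      forall s : R, gamma (s + L) = gamma s
    & forall s t : R, 0 <= s < L -> 0 <= t < L -> gamma s = gamma t -> s = t].

Definition union_of_closed_curves (R : realType) (n : nat)
    (K : set 'rV[R]_n) : Prop :=
  exists (m : nat) (gamma : 'I_m -> R -> 'rV[R]_n) (L : 'I_m -> R),
    [/\ forall i : 'I_m, closed_curve (gamma i) (L i),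
        trivIset [set: 'I_m] (fun i : 'I_m => range (gamma i))
      & K = \bigcup_(i in [set: 'I_m]) range (gamma i)].

Definition component_param (R : realType) (n : nat) (K : set 'rV[R]_n)
    (gamma : R -> 'rV[R]_n) (L : R) : Prop :=
  closed_curve gamma L /\
  exists2 q : 'rV[R]_n, K q & range gamma = connected_component K q.

(* Functions on K are total functions on R^n of which only the values on K are
   ever used. *)
Definition class_C_on (R : realType) (n : nat) (k : nat) (K : set 'rV[R]_n)
    (mu : 'rV[R]_n -> R) : Prop :=
  forall (gamma : R -> 'rV[R]_n) (L : R),
    component_param K gamma L -> class_C k (mu \o gamma).

Definition normal_vector (R : realType) (n : nat) (K : set 'rV[R]_n)
    (q w : 'rV[R]_n) : Prop :=
  forall (gamma : R -> 'rV[R]_n) (L s : R),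
    component_param K gamma L -> gamma s = q -> dot w (gamma^`()%classic s) = 0.

(* mu'(s) gamma'(s) at q = gamma(s); the value depends neither on the unit
   speed parametrization gamma nor on s, and it is 0 off K. *)
Definition grad (R : realType) (n : nat) (K : set 'rV[R]_n)
    (mu : 'rV[R]_n -> R) (q : 'rV[R]_n) : 'rV[R]_n :=
  xget 0 [set g | exists (gamma : R -> 'rV[R]_n) (L s : R),
    [/\ component_param K gamma L, gamma s = q
      & g = (mu \o gamma)^`()%classic s *: gamma^`()%classic s]].

(* Only meaningful for w normal to K at q with |grad mu(q)| |w| <= 1;
   [Num.sqrt] is 0 on negative numbers. *)
Definition expmu (R : realType) (n : nat) (K : set 'rV[R]_n)
    (mu : 'rV[R]_n -> R) (q w : 'rV[R]_n) : 'rV[R]_n :=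
  q - (mu q * enorm w ^+ 2) *: grad K mu q
    + (mu q * Num.sqrt (1 - enorm (grad K mu q) ^+ 2 * enorm w ^+ 2)) *: w.

Definition curvature (R : realType) (n : nat) (gamma : R -> 'rV[R]_n)
    (s : R) : R :=
  enorm (gamma^`(2)%classic s).

(* Equals 0 where the curvature vanishes, since [0^-1 = 0]. *)
Definition principal_normal (R : realType) (n : nat)
    (gamma : R -> 'rV[R]_n) (s : R) : 'rV[R]_n :=
  (curvature gamma s)^-1 *: gamma^`(2)%classic s.

Definition Sigma (R : realType) (n : nat) (mu : 'rV[R]_n -> R)
    (x y : 'rV[R]_n) : R :=
  enorm (x - y) ^+ 2 * (mu x + mu y) ^- 2.

(* The differential of Sigma on K * K at (q1, q2) is computed in arclength
   coordinates. *)
Definition double_critical_pair (R : realType) (n : nat)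
    (K : set 'rV[R]_n) (mu : 'rV[R]_n -> R) (q1 q2 : 'rV[R]_n) : Prop :=
  q1 <> q2 /\
  exists (gamma1 gamma2 : R -> 'rV[R]_n) (L1 L2 s1 s2 : R),
    [/\ component_param K gamma1 L1, component_param K gamma2 L2,
        gamma1 s1 = q1, gamma2 s2 = q2
      & is_diff ((s1, s2) : R * R)
          (fun st : R * R => Sigma mu (gamma1 st.1) (gamma2 st.2)) (cst 0)].

(* For K nonempty the minimum exists, so [inf] is that minimum. *)
Definition half_DCSD (R : realType) (n : nat) (K : set 'rV[R]_n)
    (mu : 'rV[R]_n -> R) : R :=
  inf [set x : R | exists q1 q2 : 'rV[R]_n,
    double_critical_pair K mu q1 q2 /\
    x = enorm (q1 - q2) / (mu q1 + mu q2)].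

Definition discr (R : realType) (n : nat) (mu : 'rV[R]_n -> R)
    (gamma : R -> 'rV[R]_n) (s : R) : R :=
  (mu \o gamma)^`(2)%classic s + curvature gamma s ^+ 2 * mu (gamma s) / 4.

Definition Lambda (R : realType) (n : nat) (mu : 'rV[R]_n -> R)
    (gamma : R -> 'rV[R]_n) (s : R) : R :=
  (fun t : R => mu (gamma t) ^+ 2)^`(2)%classic s / 2
  + curvature gamma s ^+ 2 * mu (gamma s) ^+ 2 / 2
  + curvature gamma s * mu (gamma s)
    * Num.sqrt (mu (gamma s) * discr mu gamma s).

(* On a closed curve with mu > 0 of class C^2, both sets are nonempty and
   bounded, and the maximum is positive. *)
Definition FocRad_curve (R : realType) (n : nat) (mu : 'rV[R]_n -> R)
    (gamma : R -> 'rV[R]_n) : R :=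
  (Num.sqrt (Num.max
     (sup [set Lambda mu gamma s | s in [set s : R | 0 < discr mu gamma s]])
     (sup (range (fun s : R => `|(mu \o gamma)^`()%classic s| ^+ 2)))))^-1.

Definition FocRad (R : realType) (n : nat) (K : set 'rV[R]_n)
    (mu : 'rV[R]_n -> R) : R :=
  inf [set x : R | exists (gamma : R -> 'rV[R]_n) (L : R),
    component_param K gamma L /\ x = FocRad_curve mu gamma].

Definition UR (R : realType) (n : nat) (K : set 'rV[R]_n)
    (mu : 'rV[R]_n -> R) : R :=
  Num.min (half_DCSD K mu) (FocRad K mu).

Definition collapses_on (R : realType) (n : nat) (K : set 'rV[R]_n)
    (mu : 'rV[R]_n -> R) (gamma : R -> 'rV[R]_n) (r : R) (p0 : 'rV[R]_n)
    (I : set R) : Prop :=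
  forall s : R, I s -> 0 < curvature gamma s /\
    expmu K mu (gamma s) (r *: principal_normal gamma s) = p0.

Definition maximal_collapsing_interval (R : realType) (n : nat)
    (K : set 'rV[R]_n) (mu : 'rV[R]_n -> R) (gamma : R -> 'rV[R]_n) (r : R)
    (p0 : 'rV[R]_n) (I : set R) : Prop :=
  [/\ is_interval I, collapses_on K mu gamma r p0 I
    & forall J : set R, is_interval J -> collapses_on K mu gamma r p0 J ->
        I `<=` J -> J = I].

(* gamma runs on I, at unit speed, along a circle of curvature k. *)
Definition circular_arc (R : realType) (n : nat) (gamma : R -> 'rV[R]_n)
    (k : R) (I : set R) : Prop :=
  exists c e1 e2 : 'rV[R]_n,
    [/\ dot e1 e1 = 1, dot e2 e2 = 1, dot e1 e2 = 0
      & forall s : R, I s ->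
          gamma s = c + (k^-1 * cos (k * s)) *: e1
                      + (k^-1 * sin (k * s)) *: e2].

(* Main.v *)
Require Import Defs.
From HB Require Import structures.
From mathcomp Require Import all_boot all_order all_algebra.
From mathcomp Require Import all_classical all_reals all_analysis.
From mathcomp Require Import ring lra.
Set Implicit Arguments.
Unset Strict Implicit.
Unset Printing Implicit Defensive.
Import Order.TTheory GRing.Theory Num.Theory.
Import numFieldNormedType.Exports.
Local Open Scope ring_scope.
Local Open Scope classical_set_scope.

(** Fix a point [p] and let [f s = |p - gamma s| ^ 2 / mu (gamma s) ^ 2].  If
    [p] is the image of [(gamma s, r v)] under the exponential map, then [s] is a
    critical point of [f], its value is [r ^ 2], and [v] points along the normal
    part of [p - gamma s].  Two preimages of [p] are thus two critical points of
    weighted distances to [p], both below the level [UR ^ 2].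

    Below the focal level every critical point of [f] is a local minimum
    ([critical_local_min]).  With [H = mu ^ 2 f'], [b] the normal part of
    [p - gamma s] and [disc = mu'' + kappa ^ 2 mu / 4], the identity
    [wslope'_identity] reads
      [2 f mu ^ 2 H' = |2 b - f mu ^ 2 gamma''| ^ 2 + H ^ 2 - 4 f ^ 2 mu ^ 3 disc].
    Where [disc <= 0] this makes [H] monotone.  A critical point with [disc > 0]
    is nondegenerate by the definition of the focal radius.  In the borderline
    case the function [Lambda] is above its supremum over [disc > 0], so [disc]
    is nonpositive in a whole neighbourhood and [H] is again monotone.  A function
    on a segment whose critical points are all local minima is quasiconvex, and
    constant if both ends are critical ([quasiconvex_segment],
    [critical_ends_constant]).

    It remains to join the two base points by an arc on which [f] stays below
    the focal level ([sublevel_arc]).  Suppose that both arcs between two points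
    close to [p] contain a point far from [p].  Among all such configurations,
    with [p] varying too, take one that minimizes the larger of the two small
    weighted distances.  By quasiconvexity the far points survive small
    perturbations, so this is a local minimum; then [p] is the weighted midpoint
    and the pair is a local minimum of [Sigma], hence a double critical pair
    closer than [half_DCSD].  Points on different components are excluded in the
    same way, by a minimum of [Sigma] ([close_same_component]).

    On the arc so obtained [f] is constant, so [H] and [H'] vanish, and the
    identity forces [disc = 0] and [2 b = r ^ 2 mu ^ 2 gamma''].  Everything said
    about the arc follows by differentiating these two equations.  Finally [mu] is
    strictly concave on the arc, which by Rolle's theorem is impossible on a whole
    closed curve ([arc_not_full]). *)

(** * Euclidean vectors and calculus on the line *)

Section Euclid.
Variables (R : realType) (n : nat).
Implicit Types u v w : 'rV[R]_n.

Lemma dotC u v : dot u v = dot v u.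
Proof. by apply: eq_bigr => i _; rewrite mulrC. Qed.

Lemma dotDl u v w : dot (u + v) w = dot u w + dot v w.
Proof. by rewrite /dot -big_split; apply: eq_bigr => i _; rewrite mxE mulrDl. Qed.

Lemma dotZl a u v : dot (a *: u) v = a * dot u v.
Proof. by rewrite /dot mulr_sumr; apply: eq_bigr => i _; rewrite mxE mulrA. Qed.

Lemma dotDr u v w : dot u (v + w) = dot u v + dot u w.
Proof. by rewrite !(dotC u) dotDl. Qed.

Lemma dotZr a u v : dot u (a *: v) = a * dot u v.
Proof. by rewrite !(dotC u) dotZl. Qed.

Lemma dotNl u v : dot (- u) v = - dot u v.
Proof. by rewrite -scaleN1r dotZl mulN1r. Qed.

Lemma dotNr u v : dot u (- v) = - dot u v.
Proof. by rewrite !(dotC u) dotNl. Qed.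

Lemma dot0l u : dot 0 u = 0.
Proof. by rewrite -(scale0r 0) dotZl mul0r. Qed.

Definition dotE := (dotDl, dotDr, dotNl, dotNr, dotZl, dotZr).

Lemma dot_ge0 u : 0 <= dot u u.
Proof. by apply: sumr_ge0 => i _; rewrite -expr2 sqr_ge0. Qed.

Lemma dot_eq0 u : dot u u = 0 -> u = 0.
Proof.
move=> /eqP; rewrite psumr_eq0 => [/allP h|i _]; last by rewrite -expr2 sqr_ge0.
apply/rowP => i; rewrite mxE; apply/eqP.
by have := h i (mem_index_enum i); rewrite /= mulf_eq0 orbb.
Qed.

Lemma dot_gt0 u : u <> 0 -> 0 < dot u u.
Proof. by move=> u0; rewrite lt0r dot_ge0 andbT; apply/eqP => /dot_eq0. Qed.

Lemma enorm_ge0 u : 0 <= enorm u.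
Proof. exact: sqrtr_ge0. Qed.

Lemma enorm_sqr u : enorm u ^+ 2 = dot u u.
Proof. by rewrite sqr_sqrtr // dot_ge0. Qed.

Lemma enorm_eq1 u : enorm u = 1 -> dot u u = 1.
Proof. by rewrite -enorm_sqr => ->; rewrite expr1n. Qed.

Lemma dot_CS u v : dot u v ^+ 2 <= dot u u * dot v v.
Proof.
have [->|/eqP v0] := eqVneq v 0.
  by rewrite (dotC u) !dot0l expr0n mulr0.
have hv := dot_gt0 v0; have := dot_ge0 (dot v v *: u - dot u v *: v).
rewrite !dotE (dotC v u) => h.
have : 0 <= dot v v * (dot u u * dot v v - dot u v ^+ 2) by nra.
by rewrite pmulr_rge0 // subr_ge0.
Qed.

Lemma dot_le_enorm u v : dot u v <= enorm u * enorm v.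
Proof.
have [h|/ltW h] := leP (dot u v) 0.
  by apply: le_trans h _; rewrite mulr_ge0 // enorm_ge0.
rewrite -(ler_pXn2r (ltn0Sn 1)) ?nnegrE ?mulr_ge0 ?enorm_ge0 //.
by rewrite exprMn !enorm_sqr dot_CS.
Qed.

Lemma dot_subC u v : dot (u - v) (u - v) = dot (v - u) (v - u).
Proof. by rewrite -opprB dotNl dotNr opprK. Qed.

(** Stewart's formula for the point that divides a segment. *)
Lemma dot_barycenter (p x y : 'rV[R]_n) (a : R) :
  dot (p - ((1 - a) *: x + a *: y)) (p - ((1 - a) *: x + a *: y)) =
  (1 - a) * dot (p - x) (p - x) + a * dot (p - y) (p - y)
  - a * (1 - a) * dot (x - y) (x - y).
Proof.
rewrite !dotE (dotC x p) (dotC y p) (dotC y x); ring.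
Qed.

Lemma coord_le_dot u i : `|u 0 i| ^+ 2 <= dot u u.
Proof.
rewrite /dot (bigD1 i) //= real_normK ?num_real // -expr2 lerDl.
by apply: sumr_ge0 => j _; rewrite -expr2 sqr_ge0.
Qed.

Lemma dot_continuous (T : topologicalType) (f g : T -> 'rV[R]_n) x :
  {for x, continuous f} -> {for x, continuous g} ->
  {for x, continuous (fun t => dot (f t) (g t))}.
Proof.
move=> cf cg; rewrite /dot.
have -> : (fun t => \sum_(i < n) f t 0 i * g t 0 i) =
  \sum_(i < n) (fun t => f t 0 i * g t 0 i) by apply/funext => t; rewrite fct_sumE.
apply: (big_ind (fun h : T -> R => {for x, continuous h})) => [|h k ch ck|i _].
  exact: (@cst_continuous T R (0 : R) x).
  exact: continuousD.
apply: continuousM.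
  exact: (continuous_comp cf (@coord_continuous R 1 n 0 i _)).
exact: (continuous_comp cg (@coord_continuous R 1 n 0 i _)).
Qed.

End Euclid.

Section Continuity.
Variables (R : realType) (T : topologicalType) (x : T).
Implicit Types f g : T -> R.

Lemma cont_add f g : {for x, continuous f} -> {for x, continuous g} ->
  {for x, continuous (fun t => f t + g t)}.
Proof. exact: continuousD. Qed.

Lemma cont_mul f g : {for x, continuous f} -> {for x, continuous g} ->
  {for x, continuous (fun t => f t * g t)}.
Proof. exact: continuousM. Qed.

Lemma cont_comp (h : R -> R) f : continuous h -> {for x, continuous f} ->
  {for x, continuous (fun t => h (f t))}.
Proof. by move=> ch cf; apply: (continuous_comp cf); exact: ch. Qed.

Lemma cont_div f g : g x != 0 -> {for x, continuous f} -> {for x, continuous g} ->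
  {for x, continuous (fun t => f t / g t)}.
Proof. by move=> g0 cf cg; apply: cont_mul => //; exact: cvgV. Qed.

Lemma cont_const (c : R) : {for x, continuous (fun _ => c)}.
Proof. exact: cst_continuous. Qed.

Lemma cont_near_gt f c : {for x, continuous f} -> c < f x ->
  \forall t \near x, c < f t.
Proof.
by move=> cf h; apply: (cf [set y | c < y]); apply: open_nbhs_nbhs;
  split => //; exact: open_gt.
Qed.

Lemma cont_near_lt f c : {for x, continuous f} -> f x < c ->
  \forall t \near x, f t < c.
Proof.
by move=> cf h; apply: (cf [set y | y < c]); apply: open_nbhs_nbhs;
  split => //; exact: open_lt.
Qed.

Lemma cont_pair (V W : topologicalType) (f : T -> V) (g : T -> W) :
  {for x, continuous f} -> {for x, continuous g} ->
  {for x, continuous (fun t => (f t, g t))}.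
Proof. by move=> cf cg; exact: cvg_pair. Qed.

Lemma cont_lincomb (V : normedModType R) f g (u v : T -> V) :
  {for x, continuous f} -> {for x, continuous g} ->
  {for x, continuous u} -> {for x, continuous v} ->
  {for x, continuous (fun t => f t *: u t + g t *: v t)}.
Proof. by move=> cf cg cu cv; apply: cvgD; exact: cvgZ. Qed.

End Continuity.

Section Calculus.
Variable R : realType.

Lemma is_derive_cont (V : normedModType R) (f : R -> V) (s : R) (d : V) :
  is_derive s 1 f d -> {for s, continuous f}.
Proof. by move=> [h _]; apply/differentiable_continuous/derivable1_diffP. Qed.

Lemma is_derive_ext (V : normedModType R) (f g : R -> V) (s : R) (d e : V) :
  is_derive s 1 f d -> (forall t, f t = g t) -> d = e -> is_derive s 1 g e.
Proof. by move=> h fg <-; rewrite (_ : g = f) //; apply/funext. Qed.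

Lemma is_derive_const (V : normedModType R) (c : V) (s : R) :
  is_derive s 1 (fun _ => c) 0.
Proof. exact: is_derive_cst. Qed.

Lemma is_derive_add (V : normedModType R) (f g : R -> V) (s : R) (a b : V) :
  is_derive s 1 f a -> is_derive s 1 g b ->
  is_derive s 1 (fun t => f t + g t) (a + b).
Proof. exact: is_deriveD. Qed.

Lemma is_derive_sub (V : normedModType R) (f g : R -> V) (s : R) (a b : V) :
  is_derive s 1 f a -> is_derive s 1 g b ->
  is_derive s 1 (fun t => f t - g t) (a - b).
Proof. exact: is_deriveB. Qed.

Lemma is_derive_mul (f g : R -> R) (s a b : R) :
  is_derive s 1 f a -> is_derive s 1 g b ->
  is_derive s 1 (fun t => f t * g t) (a * g s + f s * b).
Proof.
move=> fa gb; apply: is_derive_ext (is_deriveM fa gb) _ _ => //.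
by rewrite addrC; congr (_ + _); exact: mulrC.
Qed.

Lemma is_derive_coord m (f : R -> 'rV[R]_m) (s : R) (d : 'rV[R]_m) i :
  is_derive s 1 f d -> is_derive s 1 (fun t => f t 0 i) (d 0 i).
Proof.
move=> [df <-]; rewrite derive_mx // mxE; apply: derivableP.
by move/derivable_mxP : df; apply.
Qed.

Lemma is_derive_row m (f : R -> 'rV[R]_m) (s : R) (d : 'rV[R]_m) :
  (forall i, is_derive s 1 (fun t => f t 0 i) (d 0 i)) -> is_derive s 1 f d.
Proof.
move=> h; have df : derivable f s 1.
  by apply/derivable_mxP => i j; rewrite (ord1 i); case: (h j).
apply: DeriveDef => //; rewrite derive_mx //; apply/rowP => i; rewrite mxE.
by case: (h i).
Qed.

Lemma is_derive_dot m (f g : R -> 'rV[R]_m) (s : R) (a b : 'rV[R]_m) :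
  is_derive s 1 f a -> is_derive s 1 g b ->
  is_derive s 1 (fun t => dot (f t) (g t)) (dot a (g s) + dot (f s) b).
Proof.
move=> fa gb.
have h i := is_derive_mul (is_derive_coord i fa) (is_derive_coord i gb).
apply: is_derive_ext (is_derive_sum h) _ _ => [t|]; rewrite ?fct_sumE //.
by rewrite big_split.
Qed.

Lemma is_derive_scale m (f : R -> R) (g : R -> 'rV[R]_m) (s a : R) (b : 'rV[R]_m) :
  is_derive s 1 f a -> is_derive s 1 g b ->
  is_derive s 1 (fun t => f t *: g t) (a *: g s + f s *: b).
Proof.
move=> fa gb; apply: is_derive_row => i.
apply: is_derive_ext (is_derive_mul fa (is_derive_coord i gb)) _ _ => [t|].
  by rewrite mxE.
by rewrite !mxE.
Qed.

Lemma is_derive_div (f g : R -> R) (s a b : R) : g s != 0 ->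
  is_derive s 1 f a -> is_derive s 1 g b ->
  is_derive s 1 (fun t => f t / g t) ((a * g s - f s * b) / g s ^+ 2).
Proof.
move=> g0 fa gb; apply: is_derive_ext (is_derive_mul fa (is_deriveV g0 gb)) _ _ => //.
by rewrite /= [_ *: b]mulNr; field.
Qed.

End Calculus.

(** * Functions whose critical points are local minima *)

Section RealLine.
Variable R : realType.
Implicit Types (f df : R -> R) (a b s t x y z : R).

Lemma is_derive_uniq (V : normedModType R) (f : R -> V) s (d e : V) :
  is_derive s 1 f d -> is_derive s 1 f e -> d = e.
Proof. by case=> _ <- [_ <-]. Qed.

Lemma near_ball z (P : R -> Prop) :
  (\forall s \near z, P s) -> exists2 e, 0 < e & forall s, `|s - z| < e -> P s.
Proof.
move=> /nbhs_ballP[e /= e0 h]; exists e => // s se; apply: h.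
by rewrite /ball /= distrC.
Qed.

Lemma ball_near z e (P : R -> Prop) : 0 < e ->
  (forall s, `|s - z| < e -> P s) -> \forall s \near z, P s.
Proof.
move=> e0 h; apply/nbhs_ballP; exists e => // s; rewrite /ball /= distrC.
exact: h.
Qed.

Lemma mean_value f df x y : (forall s, is_derive s 1 f (df s)) -> x < y ->
  exists2 c, x < c < y & f y - f x = df c * (y - x).
Proof.
move=> fd xy; have [//|c cxy e] := @MVT _ f df x y xy (fun s _ => fd s).
  by apply: continuous_subspaceT => s; apply: is_derive_cont (fd s).
by exists c => //; rewrite in_itv in cxy.
Qed.

Lemma derive_sign_local_min f df z : (forall s, is_derive s 1 f (df s)) ->
  (\forall s \near z, 0 <= df s * (s - z)) -> \forall s \near z, f z <= f s.
Proof.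
move=> fd /near_ball[e e0 h]; apply: (ball_near e0) => s; rewrite ltr_norml => se.
rewrite -subr_ge0; have [zs|sz|->] := ltgtP z s; last by rewrite subrr.
  have [c c1 ->] := mean_value fd zs.
  have := h c; rewrite ltr_norml => /(_ ltac:(lra)); rewrite pmulr_lge0; last lra.
  by move=> hc; apply: mulr_ge0 => //; lra.
have [c c1 e1] := mean_value fd sz; rewrite -opprB e1.
have := h c; rewrite ltr_norml => /(_ ltac:(lra)); rewrite nmulr_lge0; last lra.
by move=> hc; rewrite oppr_ge0; apply: mulr_le0_ge0 => //; lra.
Qed.

Lemma derive_pos_sign f z d : is_derive z 1 f d -> 0 < d -> f z = 0 ->
  \forall s \near z, 0 <= f s * (s - z).
Proof.
move=> [df dE] d0 fz0; have /cvgrPdist_lt /(_ d d0) := df.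
rewrite -/('D_1 f z) dE => /nbhs_ballP[e /= e0 h].
apply: (ball_near e0) => s se; have [->|sz] := eqVneq s z.
  by rewrite subrr mulr0.
have := h (s - z); rewrite /ball /= sub0r normrN => /(_ se).
rewrite subr_eq0 => /(_ sz); rewrite fz0 subr0 [_ *: 1]mulr1 subrK.
rewrite ltr_norml => /andP[_]; rewrite ltrBlDl ltrDr => q.
have -> : f s = (s - z) * ((s - z)^-1 *: f s).
  by apply: esym; apply: mulVKf; rewrite subr_eq0.
by rewrite mulrAC -expr2 mulr_ge0 ?sqr_ge0 // ltW.
Qed.

Lemma local_max_critical f df a b z : (forall s, is_derive s 1 f (df s)) ->
  a < z < b -> (forall s, a <= s <= b -> f s <= f z) -> df z = 0.
Proof.
move=> fd /andP[az zb] h; apply: is_derive_uniq (fd z) _.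
apply: (@derive1_at_max _ f a b) => [||| t].
- exact: ltW (lt_trans az zb).
- by move=> t _; case: (fd t).
- by rewrite in_itv /= az.
- by rewrite in_itv /= => /andP[at_ tb]; apply: h; rewrite !ltW.
Qed.

(** The set where [f] reaches its maximum is closed; where every critical point
    is a local minimum it is also open, hence the whole interval. *)
Lemma max_critical_constant f df a b z : (forall s, is_derive s 1 f (df s)) ->
  a <= z <= b -> df z = 0 -> (forall s, a <= s <= b -> f s <= f z) ->
  (forall w, a <= w <= b -> df w = 0 -> \forall s \near w, f w <= f s) ->
  forall s, a <= s <= b -> f s = f z.
Proof.
move=> fd azb dz fz lmin.
have cf s : {for s, continuous f} by exact: is_derive_cont (fd s).
(* An end of the segment other than [z] need not be critical; it is reached by
   continuity once the equality holds on [A]. *)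
pose A : set R := [set t | a < t < b \/ t = z].
have Aab t : A t -> a <= t <= b.
  by case=> [/andP[at_ tb]|->//]; rewrite !ltW.
have Acon : connected A.
  apply/connected_intervalP => x y Ax Ay t /andP[xt ty].
  have := Aab _ Ax; have := Aab _ Ay.
  have [->//|tx] := eqVneq t x; have [->//|tny] := eqVneq t y.
  have {}xt : x < t by rewrite lt_neqAle eq_sym tx.
  have {}ty : t < y by rewrite lt_neqAle tny.
  by move=> h1 h2; left; lra.
have eqA : A `&` [set t | f t = f z] = A.
  apply: Acon; first by exists z; split => //; right.
    exists (interior [set t | A t -> f t = f z]); first exact: open_interior.
    apply/seteqP; split => t [At ft]; split => //; last first.
      exact: (interior_subset ft).
    have dt : df t = 0.
      case: At => [tab|->//]; apply: (local_max_critical fd tab) => s sab.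
      by rewrite ft; apply: fz.
    apply: filterS (lmin t (Aab _ At) dt) => s fs As.
    by apply/eqP; rewrite eq_le fz ?Aab //= -ft.
  exists [set t | f t = f z] => //.
  have -> : [set t | f t = f z] = f @^-1` [set f z] by [].
  exact: (proj1 (continuous_closedP f) cf _ (@closed_eq _ (f z))).
have inA t : A t -> f t = f z by rewrite -{1}eqA => -[].
move=> s sab; apply/eqP; rewrite eq_le fz //= leNgt; apply/negP => fs.
have [e e0 h] : exists2 e, 0 < e & forall t, `|t - s| < e -> f t < f z.
  exact: near_ball (cont_near_lt (cf s) fs).
have sz : s <> z by move=> e1; rewrite e1 ltxx in fs.
pose d := Num.min (e / 2) (`|z - s| / 2).
have zs0 : 0 < `|z - s| by rewrite normr_gt0 subr_eq0; apply/eqP => /esym.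
have d0 : 0 < d by rewrite lt_min !divr_gt0.
have [d1 d2] : d < e /\ d < `|z - s|.
  by rewrite /d; split; rewrite gt_min; apply/orP; [left|right]; lra.
have [lt_sz|lt_zs|//] := ltgtP s z.
  have hd : `|s + d - s| < e by rewrite addrC addKr gtr0_norm.
  have := h _ hd; rewrite inA ?ltxx //.
  by left; move: d2; rewrite gtr0_norm ?subr_gt0 //; lra.
have hd : `|s - d - s| < e by rewrite addrC addKr normrN gtr0_norm.
have := h _ hd; rewrite inA ?ltxx //.
by left; move: d2; rewrite ltr0_norm ?subr_lt0 //; lra.
Qed.

(** An interior maximum is critical, so [max_critical_constant] makes the function
    constant. *)
Lemma quasiconvex_segment f df a b : (forall s, is_derive s 1 f (df s)) ->
  (forall w, a <= w <= b -> df w = 0 -> \forall s \near w, f w <= f s) ->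
  forall s, a <= s <= b -> f s <= Num.max (f a) (f b).
Proof.
move=> fd lmin s sab; have ab : a <= b by lra.
have [|z] := @EVT_max _ f a b ab.
  by apply: continuous_subspaceT => t; apply: is_derive_cont (fd t).
rewrite in_itv => /= zab fz.
have {}fz t : a <= t <= b -> f t <= f z by move=> tab; apply: fz; rewrite in_itv.
apply: le_trans (fz s sab) _; rewrite le_max.
have [->|za] := eqVneq z a; first by rewrite lexx.
have [->|zb] := eqVneq z b; first by rewrite lexx orbT.
have zab' : a < z < b.
  by case/andP: zab => h1 h2; rewrite !lt_neqAle h1 h2 eq_sym za zb.
have dz := local_max_critical fd zab' fz.
by rewrite -(max_critical_constant fd zab dz fz lmin (s := a)) ?lexx //; lra.
Qed.

(** The maximum is attained at a critical point, even if that point is an end. *)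
Lemma critical_ends_constant f df a b : (forall s, is_derive s 1 f (df s)) ->
  df a = 0 -> df b = 0 ->
  (forall w, a <= w <= b -> df w = 0 -> \forall s \near w, f w <= f s) ->
  forall s, a <= s <= b -> f s = f a.
Proof.
move=> fd da db lmin s sab; have ab : a <= b by lra.
have [|z] := @EVT_max _ f a b ab.
  by apply: continuous_subspaceT => t; apply: is_derive_cont (fd t).
rewrite in_itv => /= zab fz.
have {}fz t : a <= t <= b -> f t <= f z by move=> tab; apply: fz; rewrite in_itv.
have dz : df z = 0.
  have [->//|za] := eqVneq z a; have [->//|zb] := eqVneq z b.
  apply: (@local_max_critical f df a b) => //.
  by case/andP: zab => h1 h2; rewrite !lt_neqAle h1 h2 eq_sym za zb.
have h := max_critical_constant fd zab dz fz lmin.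
by rewrite !h ?lexx.
Qed.

(** One-sided difference quotients suffice, so the ends of [J] are included. *)
Lemma derive_constant_on (V : normedModType R) (J : set R) (g : R -> V) c x y d :
  is_interval J -> J x -> J y -> x <> y -> (forall t, J t -> g t = c) ->
  is_derive x 1 g d -> d = 0.
Proof.
move=> iJ Jx Jy xy gc [dg <-]; apply/eqP/negP => /negP d0.
have /cvgrPdist_lt /(_ `|'D_1 g x|) := dg.
rewrite normr_gt0 => /(_ d0); rewrite -/('D_1 g x) => /nbhs_ballP[e /= e0 h].
pose k := Num.min (1 / 2) (e / 2 / `|y - x|).
have yx0 : 0 < `|y - x| by rewrite normr_gt0 subr_eq0; apply/eqP => /esym.
have k0 : 0 < k by rewrite lt_min !divr_gt0.
have k1 : k < 1 by rewrite /k gt_min; apply/orP; left; lra.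
have k2 : k * `|y - x| < e.
  have : k <= e / 2 / `|y - x| by rewrite /k ge_min lexx orbT.
  by rewrite ler_pdivlMr // => /le_lt_trans; apply; lra.
have := h (k * (y - x)); rewrite /ball /= sub0r normrN normrM (gtr0_norm k0).
move=> /(_ k2); rewrite mulf_eq0 (gt_eqF k0) /= subr_eq0.
have yx : y != x by apply/eqP => /esym.
move=> /(_ yx); rewrite !gc //.
  by rewrite subrr scaler0 subr0 ltxx.
rewrite /= [_ *: 1]mulr1.
have [lxy|lyx|//] := ltgtP x y.
  by apply: (iJ x y) => //; apply/andP; split; nra.
by apply: (iJ y x) => //; apply/andP; split; nra.
Qed.

Lemma constant_on_interval (J : set R) f df x y : is_interval J ->
  (forall s, is_derive s 1 f (df s)) -> (forall s, J s -> df s = 0) ->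
  J x -> J y -> f x = f y.
Proof.
move=> iJ fd d0 Jx Jy.
wlog xy : x y Jx Jy / x < y => [H|].
  by have [xy|yx|->//] := ltgtP x y; [|symmetry]; apply: H.
have [c /andP[xc cy] e] := mean_value fd xy.
apply/eqP; rewrite eq_sym -subr_eq0 e d0 ?mul0r //.
by apply: iJ Jx Jy _ _; rewrite !ltW.
Qed.

End RealLine.

(** * The weighted distance from a point to a curve *)

Section Focal.
Variables (R : realType) (n : nat) (g g1 g2 : R -> 'rV[R]_n) (m m1 m2 : R -> R).
Hypothesis gd : forall s : R, is_derive s 1 g (g1 s).
Hypothesis g1d : forall s : R, is_derive s 1 g1 (g2 s).
Hypothesis g2c : continuous g2.
Hypothesis md : forall s : R, is_derive s 1 m (m1 s).
Hypothesis m1d : forall s : R, is_derive s 1 m1 (m2 s).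
Hypothesis m2c : continuous m2.
Hypothesis unit_speed : forall s : R, dot (g1 s) (g1 s) = 1.
Hypothesis m_gt0 : forall s : R, 0 < m s.

Definition wdist2 (p : 'rV[R]_n) (s : R) : R :=
  dot (p - g s) (p - g s) / m s ^+ 2.

(** [m ^+ 2] times the derivative of [wdist2 p]; the factor makes the
    identity below free of terms linear in the slope. *)
Definition wslope (p : 'rV[R]_n) (s : R) : R :=
  - (2 * dot (p - g s) (g1 s)) - 2 * (wdist2 p s * (m s * m1 s)).

Definition wslope' (p : 'rV[R]_n) (s : R) : R :=
  2 - 2 * dot (p - g s) (g2 s)
  - 2 * (wslope p s / m s ^+ 2 * (m s * m1 s)
         + wdist2 p s * (m1 s ^+ 2 + m s * m2 s)).

Definition disc (s : R) : R := m2 s + dot (g2 s) (g2 s) * m s / 4.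

(** At a critical point where [wdist2] is [f], the second derivative is at least a
    positive multiple of [x ^ 2 - |g2| m x - m m2], with [x ^ 2 = 1 / f - m1 ^ 2].
    Where [disc >= 0], this is the value of [1 / f] at the larger root. *)
Definition focal (s : R) : R :=
  m1 s ^+ 2 + m s * m2 s + dot (g2 s) (g2 s) * m s ^+ 2 / 2
  + enorm (g2 s) * m s * Num.sqrt (m s * disc s).

Definition normal_part (p : 'rV[R]_n) (s : R) : 'rV[R]_n :=
  p - g s - dot (p - g s) (g1 s) *: g1 s.

Let m_neq0 s : m s != 0. Proof. by rewrite gt_eqF. Qed.

Lemma wdist2_ge0 (p : 'rV[R]_n) (s : R) : 0 <= wdist2 p s.
Proof. by rewrite divr_ge0 ?dot_ge0 ?sqr_ge0. Qed.

Lemma velocity_accel (s : R) : dot (g1 s) (g2 s) = 0.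
Proof.
have h := is_derive_dot (g1d s) (g1d s).
have e : (fun t => dot (g1 t) (g1 t)) = cst 1 by apply/funext => t; exact: unit_speed.
rewrite e in h; have := is_derive_uniq h (is_derive_cst (1 : R) s (1 : R)).
by rewrite (dotC (g2 s)) => h2; lra.
Qed.

Lemma is_derive_wdist2 (p : 'rV[R]_n) (s : R) : is_derive s 1 (wdist2 p) (wslope p s / m s ^+ 2).
Proof.
have hu : is_derive s 1 (fun t => p - g t) (0 - g1 s).
  exact: is_derive_sub (is_derive_cst (p : 'rV[R]_n) s (1 : R)) (gd s).
apply: is_derive_ext (is_derive_div _ (is_derive_dot hu hu)
  (is_derive_mul (md s) (md s))) _ _ => //; first by rewrite mulf_neq0.
by rewrite /wslope /wdist2 sub0r !(dotNl, dotNr) (dotC (g1 s)); field.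
Qed.

Lemma is_derive_wslope (p : 'rV[R]_n) (s : R) : is_derive s 1 (wslope p) (wslope' p s).
Proof.
have hu : is_derive s 1 (fun t => p - g t) (0 - g1 s).
  exact: is_derive_sub (is_derive_cst (p : 'rV[R]_n) s (1 : R)) (gd s).
have h1 := is_derive_mul (is_derive_cst (-2 : R) s (1 : R)) (is_derive_dot hu (g1d s)).
have h2 := is_derive_mul (is_derive_cst (2 : R) s (1 : R))
  (is_derive_mul (is_derive_wdist2 p s) (is_derive_mul (md s) (m1d s))).
apply: is_derive_ext (is_derive_sub h1 h2) _ _ => [t|] /=.
  by rewrite /wslope /=; ring.
by rewrite /wslope' sub0r dotNl unit_speed /=; ring.
Qed.

(** The square is the defect in Young's inequality for the product of [g2 s] with
    the normal part of [p - g s].  Where [disc <= 0] the identity makes the slope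
    monotone; where the slope, its derivative and [disc] vanish, it makes the
    square vanish, which determines that normal part. *)
Lemma wslope'_identity (p : 'rV[R]_n) (s : R) :
  2 * wdist2 p s * m s ^+ 2 * wslope' p s =
  dot (2 *: normal_part p s - (wdist2 p s * m s ^+ 2) *: g2 s)
      (2 *: normal_part p s - (wdist2 p s * m s ^+ 2) *: g2 s)
  + wslope p s ^+ 2 - 4 * wdist2 p s ^+ 2 * m s ^+ 3 * disc s.
Proof.
have hF : dot (p - g s) (p - g s) = wdist2 p s * m s ^+ 2.
  by rewrite /wdist2 divfK // expf_neq0.
have ha : dot (p - g s) (g1 s) = - (wslope p s / 2 + wdist2 p s * (m s * m1 s)).
  by rewrite /wslope; field.
have vg := velocity_accel s; have us := unit_speed s.
move: hF ha; rewrite /normal_part /wslope' /disc.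
set u := p - g s; set F := wdist2 p s; set H := wslope p s => hF ha.
have -> : dot (2 *: (u - dot u (g1 s) *: g1 s) - (F * m s ^+ 2) *: g2 s)
      (2 *: (u - dot u (g1 s) *: g1 s) - (F * m s ^+ 2) *: g2 s) =
  4 * (dot u u - dot u (g1 s) ^+ 2) - 4 * F * m s ^+ 2 * dot u (g2 s)
  + F ^+ 2 * m s ^+ 4 * dot (g2 s) (g2 s).
  clearbody u F H; rewrite !(dotDl, dotDr, dotNl, dotNr, dotZl, dotZr).
  rewrite (dotC (g2 s) u) (dotC (g2 s) (g1 s)) (dotC (g1 s) u) vg us; ring.
rewrite ha hF; field; exact: m_neq0.
Qed.

Lemma normal_part_sqr (p : 'rV[R]_n) (s : R) : wslope p s = 0 ->
  dot (normal_part p s) (normal_part p s)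
  = wdist2 p s * m s ^+ 2 * (1 - wdist2 p s * m1 s ^+ 2).
Proof.
move=> h0.
have hF : dot (p - g s) (p - g s) = wdist2 p s * m s ^+ 2.
  by rewrite /wdist2 divfK // expf_neq0.
have ha : dot (p - g s) (g1 s) = - (wdist2 p s * (m s * m1 s)).
  by move: h0; rewrite /wslope => h0; lra.
rewrite /normal_part; have us := unit_speed s; move: hF ha.
set u := p - g s => hF ha; clearbody u.
rewrite !(dotDl, dotDr, dotNl, dotNr, dotZl, dotZr) (dotC (g1 s) u) us hF ha.
ring.
Qed.

(** Cauchy-Schwarz for the normal part and [g2 s] reduces the claim to the
    quadratic polynomial behind [focal]. *)
Lemma wslope'_gt0 (p : 'rV[R]_n) (s : R) : wslope p s = 0 -> 0 < wdist2 p s -> 0 <= disc s ->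
  wdist2 p s * focal s < 1 -> 0 < wslope' p s.
Proof.
move=> h0 F0 d0 Fl.
have mp := m_gt0 s; have md0 : 0 <= m s * disc s by rewrite mulr_ge0 // ltW.
have hb := normal_part_sqr h0.
have hug : dot (p - g s) (g2 s) = dot (normal_part p s) (g2 s).
  rewrite /normal_part; set u := p - g s; clearbody u.
  by rewrite dotDl dotNl dotZl velocity_accel mulr0 subr0.
have cs := dot_le_enorm (normal_part p s) (g2 s).
have b0 := enorm_ge0 (normal_part p s); have k0 := enorm_ge0 (g2 s).
have bE := enorm_sqr (normal_part p s); have kE := enorm_sqr (g2 s).
have y0 := sqrtr_ge0 (m s * disc s); have yE := sqr_sqrtr md0.
move: y0 Fl yE; rewrite /wslope' /focal h0 mul0r mul0r add0r hug hb -kE in bE *.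
rewrite /disc -kE.
move: cs b0 k0 bE F0; set F := wdist2 p s; set b := enorm _; set k := enorm _.
set y := Num.sqrt _ => cs b0 k0 bE F0 y0 Fl yE.
set bg := dot _ _ in cs *.
(* [X ^ 2 = 1 / F - m1 s ^ 2], and [X] lies beyond both roots. *)
pose X := b / (F * m s).
have bX : b = X * (F * m s) by rewrite /X divfK // mulf_neq0 // gt_eqF.
have X0 : 0 <= X by rewrite divr_ge0 // ltW // mulr_gt0.
clearbody X F b k y bg.
have FX : F * X ^+ 2 = 1 - F * m1 s ^+ 2.
  have : F * m s ^+ 2 * (F * X ^+ 2) = F * m s ^+ 2 * (1 - F * m1 s ^+ 2).
    by rewrite -bE bX; ring.
  by apply: mulfI; rewrite mulf_neq0 ?expf_neq0 // gt_eqF.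
have hX : k * m s / 2 + y < X.
  have : F * (k * m s / 2 + y) ^+ 2 < F * X ^+ 2.
    rewrite FX; move: Fl yE; set q := m2 s; set a := m1 s.
    move=> Fl yE; have -> : (k * m s / 2 + y) ^+ 2 =
       m s * q + k ^+ 2 * m s ^+ 2 / 2 + k * m s * y.
      by rewrite sqrrD yE; field.
    by lra.
  rewrite ltr_pM2l // ltr_pXn2r // nnegrE // addr_ge0 // divr_ge0 //.
  by rewrite mulr_ge0 // ltW.
have e : 1 - X * (F * m s) * k - F * (m1 s ^+ 2 + m s * m2 s) =
   F * ((X - k * m s / 2 - y) * (X - k * m s / 2 + y)).
  have -> : (X - k * m s / 2 - y) * (X - k * m s / 2 + y) =
    (X - k * m s / 2) ^+ 2 - y ^+ 2 by ring.
  by rewrite yE; lra.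
have : 0 < F * ((X - k * m s / 2 - y) * (X - k * m s / 2 + y)).
  by apply: mulr_gt0 => //; apply: mulr_gt0; lra.
by rewrite -e; move: cs; rewrite bX; lra.
Qed.

Lemma disc_continuous : continuous disc.
Proof.
move=> s; have cm := is_derive_cont (md s).
have ck : {for s, continuous (fun t => dot (g2 t) (g2 t))}.
  by apply: dot_continuous; exact: g2c.
rewrite /disc; apply: (cont_add (m2c (x := s))).
exact: cont_mul (cont_mul ck cm) (@cont_const _ _ _ _).
Qed.

Lemma focal_continuous : continuous focal.
Proof.
move=> s; have cm := is_derive_cont (md s); have cm1 := is_derive_cont (m1d s).
have ck : {for s, continuous (fun t => dot (g2 t) (g2 t))}.
  by apply: dot_continuous; exact: g2c.
have sqrtc := @sqrt_continuous R.
have h2 := cont_mul cm (m2c (x := s)).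
have h3 := cont_mul (cont_mul ck (cont_mul cm cm)) (@cont_const _ _ s (2^-1)).
have h4 := cont_mul cm (disc_continuous (x := s)).
have h5 := cont_mul (cont_mul (cont_comp sqrtc ck) cm) (cont_comp sqrtc h4).
exact: cont_add (cont_add (cont_add (cont_mul cm1 cm1) h2) h3) h5.
Qed.

Section Bound.
Variable M : R.
Hypothesis focal_le : forall s : R, 0 < disc s -> focal s <= M.

(** Let [wdist2 p s] be positive; as [wdist2] is nonnegative, a zero is a minimum.
    If [disc s >= 0] and [focal s <= M], the second derivative is positive.
    Otherwise [disc <= 0] around [s]: by continuity if [disc s < 0], and if
    [focal s > M] because [focal > M] around [s], where [focal_le] excludes
    [disc > 0].  Then the slope is monotone around [s]. *)
Lemma critical_local_min (p : 'rV[R]_n) (s : R) : wdist2 p s * M < 1 -> wslope p s = 0 ->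
  \forall t \near s, wdist2 p s <= wdist2 p t.
Proof.
move=> FM h0.
have [F0|F0] := leP (wdist2 p s) 0.
  by apply: (ball_near ltr01) => t _; apply: le_trans F0 (wdist2_ge0 p t).
have [//|sgn] : (\forall t \near s, wdist2 p s <= wdist2 p t) \/
    \forall t \near s, 0 <= wslope p t * (t - s).
  right.
  have [nd|pd] : (\forall t \near s, disc t <= 0) \/ 0 < wslope' p s.
    have [d0|d0] := ltP (disc s) 0.
      left; have : \forall t \near s, disc t < 0.
        exact: cont_near_lt (disc_continuous (x := s)) d0.
      by apply: filterS => t /ltW.
    have [lM|Ml] := leP (focal s) M.
      by right; apply: wslope'_gt0 => //; apply: le_lt_trans FM; rewrite ler_pM2l.
    left; have : \forall t \near s, M < focal t.
      exact: cont_near_gt (focal_continuous (x := s)) Ml.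
    apply: filterS => t Mt; rewrite leNgt; apply/negP => /focal_le.
    by rewrite leNgt Mt.
  - have Fpos : \forall t \near s, 0 < wdist2 p t.
      exact: cont_near_gt (is_derive_cont (is_derive_wdist2 p s)) F0.
    have /near_ball[e e0 he] : \forall t \near s, 0 <= wslope' p t.
      near=> t; have Ft : 0 < wdist2 p t by near: t.
      have dt : disc t <= 0 by near: t.
      rewrite -(@pmulr_rge0 _ (2 * wdist2 p t * m t ^+ 2)); last first.
        by apply: mulr_gt0; [exact: mulr_gt0 | exact: exprn_gt0].
      rewrite wslope'_identity; apply: addr_ge0.
        by apply: addr_ge0; rewrite ?dot_ge0 ?sqr_ge0.
      rewrite -mulrN; apply: mulr_ge0; last by rewrite oppr_ge0.
      apply: mulr_ge0; last exact/ltW/exprn_gt0.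
      by rewrite mulr_ge0 ?sqr_ge0.
    apply: (ball_near e0) => t; rewrite ltr_norml => te.
    have [st|ts|->] := ltgtP s t; last by rewrite subrr mulr0.
      have [c c1] := mean_value (is_derive_wslope p) st; rewrite h0 subr0 => ->.
      rewrite -mulrA; apply: mulr_ge0; last by rewrite -expr2 sqr_ge0.
      by apply: he; rewrite ltr_norml; lra.
    have [c c1] := mean_value (is_derive_wslope p) ts.
    rewrite h0 sub0r => /eqP; rewrite eqr_oppLR => /eqP ->.
    rewrite -mulrN opprB -mulrA; apply: mulr_ge0; last by rewrite -expr2 sqr_ge0.
    by apply: he; rewrite ltr_norml; lra.
  - exact: derive_pos_sign (is_derive_wslope p s) pd h0.
apply: (derive_sign_local_min (is_derive_wdist2 p)).
apply: filterS sgn => t; rewrite mulrAC => ht.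
by rewrite mulr_ge0 // invr_ge0 sqr_ge0.
Unshelve. all: by end_near.
Qed.

(** A positive [disc s] would make the second derivative positive; with
    [disc s <= 0] both remaining terms of [wslope'_identity] are nonnegative. *)
Lemma flat_critical (p : 'rV[R]_n) (s : R) : 0 < wdist2 p s -> wdist2 p s * M < 1 ->
  wslope p s = 0 -> wslope' p s = 0 ->
  disc s = 0 /\ 2 *: normal_part p s = (wdist2 p s * m s ^+ 2) *: g2 s.
Proof.
move=> F0 FM h0 h1.
have d0 : disc s <= 0.
  rewrite leNgt; apply/negP => d0.
  have Fl : wdist2 p s * focal s < 1.
    by apply: le_lt_trans FM; rewrite ler_pM2l // focal_le.
  by have := wslope'_gt0 h0 F0 (ltW d0) Fl; rewrite h1 ltxx.
have := wslope'_identity p s; rewrite h0 h1 mulr0 expr0n addr0.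
set w := (2 *: normal_part p s - _) => e.
have c0 : 0 < 4 * wdist2 p s ^+ 2 * m s ^+ 3.
  by apply: mulr_gt0; [apply: mulr_gt0 => //|]; exact: exprn_gt0.
have w0 := dot_ge0 w.
have : 4 * wdist2 p s ^+ 2 * m s ^+ 3 * disc s <= 0 by rewrite pmulr_rle0.
move=> cd; split.
  by apply: (mulfI (lt0r_neq0 c0)); rewrite mulr0; lra.
by apply/eqP; rewrite -subr_eq0; apply/eqP/dot_eq0; rewrite -/w; lra.
Qed.

End Bound.
End Focal.

(** * Arcs on which the weighted distance is constant *)

Section Trigonometry.
Variable R : realType.
Implicit Types (w s x y : R).

Lemma is_derive_cosM w s :
  is_derive s 1 (fun t => cos (w * t)) (- (w * sin (w * s))).
Proof.
have h := is_derive_mul (is_derive_const (w : R) s) (is_derive_id s (1 : R)).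
apply: is_derive_ext (is_derive1_comp (is_derive_cos (w * s)) h) _ _ => //=.
by ring.
Qed.

Lemma is_derive_sinM w s :
  is_derive s 1 (fun t => sin (w * t)) (w * cos (w * s)).
Proof.
have h := is_derive_mul (is_derive_const (w : R) s) (is_derive_id s (1 : R)).
apply: is_derive_ext (is_derive1_comp (is_derive_sin (w * s)) h) _ _ => //=.
by ring.
Qed.

Lemma cos_sin_surj x y : x ^+ 2 + y ^+ 2 = 1 ->
  exists a : R, cos a = x /\ sin a = y.
Proof.
move=> e; have x1 : -1 <= x <= 1 by apply/andP; split; nra.
have cx : cos (acos x) = x by rewrite acosK // in_itv.
have sy : Num.sqrt (1 - x ^+ 2) = `|y| by rewrite -e addrC addKr sqrtr_sqr.
have [y0|y0] := leP 0 y.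
  by exists (acos x); rewrite cx sin_acos // sy ger0_norm.
by exists (- acos x); rewrite cosN sinN cx sin_acos // sy ltr0_norm // opprK.
Qed.

End Trigonometry.

Section Collapse.
Variables (R : realType) (n : nat) (g g1 g2 g3 : R -> 'rV[R]_n) (m m1 m2 : R -> R).
Hypothesis gd : forall s : R, is_derive s 1 g (g1 s).
Hypothesis g1d : forall s : R, is_derive s 1 g1 (g2 s).
Hypothesis g2d : forall s : R, is_derive s 1 g2 (g3 s).
Hypothesis md : forall s : R, is_derive s 1 m (m1 s).
Hypothesis m1d : forall s : R, is_derive s 1 m1 (m2 s).
Hypothesis unit_speed : forall s : R, dot (g1 s) (g1 s) = 1.
Hypothesis m_gt0 : forall s : R, 0 < m s.
Variable M : R.
Hypothesis focal_le : forall s : R, 0 < disc g2 m m2 s -> focal g2 m m1 m2 s <= M.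
Hypothesis slope_le : forall s : R, m1 s ^+ 2 <= M.
Variables (p : 'rV[R]_n) (J : set R) (x y r : R).
Hypothesis iJ : is_interval J.
Hypotheses (Jx : J x) (Jy : J y) (xy : x <> y).
Hypothesis r_gt0 : 0 < r.
Hypothesis rM : r ^+ 2 * M < 1.
Hypothesis constJ : forall s : R, J s -> wdist2 g m p s = r ^+ 2.

Let m_neq0 s : m s != 0. Proof. by rewrite gt_eqF. Qed.

Lemma derive0_on (V : normedModType R) (f : R -> V) (c : V) (s : R) (d : V) :
  J s -> (forall t, J t -> f t = c) -> is_derive s 1 f d -> d = 0.
Proof.
move=> Js fc fd; have [sx|sx] := eqVneq s x.
  by apply: (derive_constant_on iJ Jx Jy xy fc); rewrite -sx.
by apply: (derive_constant_on iJ Js Jx _ fc fd); apply/eqP.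
Qed.

Lemma collapse_slope s : J s -> wslope g g1 m m1 p s = 0.
Proof.
move=> Js; have := derive0_on Js constJ (is_derive_wdist2 gd md m_gt0 p s).
by move=> /eqP; rewrite mulf_eq0 invr_eq0 expf_eq0 (negbTE (m_neq0 s)) orbF => /eqP.
Qed.

Lemma collapse_flat s : J s -> disc g2 m m2 s = 0 /\
  2 *: normal_part g g1 p s = (r ^+ 2 * m s ^+ 2) *: g2 s.
Proof.
move=> Js; rewrite -(constJ Js); apply: flat_critical => //.
- exact: focal_le.
- by rewrite constJ // exprn_gt0.
- by rewrite constJ.
- exact: collapse_slope.
- apply: derive0_on Js collapse_slope _.
  exact: is_derive_wslope.
Qed.

Lemma collapse_m2 s : J s -> m2 s = - (dot (g2 s) (g2 s) * m s / 4).
Proof. by move=> /collapse_flat[+ _]; rewrite /disc; lra. Qed.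

(** Compare the lengths of the two sides of the vector equation in
    [collapse_flat]. *)
Lemma collapse_energy s : J s ->
  r ^+ 2 * (m1 s ^+ 2 + m s ^+ 2 * dot (g2 s) (g2 s) / 4) = 1.
Proof.
move=> Js; have [_ e] := collapse_flat Js.
have := congr1 (fun v => dot v v) e; rewrite !(dotZl, dotZr).
rewrite (normal_part_sqr unit_speed m_gt0 (collapse_slope Js)) constJ // => h.
have c0 : r ^+ 2 * m s ^+ 2 != 0 by rewrite mulf_neq0 ?expf_neq0 ?gt_eqF.
by apply: (mulfI c0); lra.
Qed.

Lemma collapse_accel_gt0 s : J s -> 0 < dot (g2 s) (g2 s).
Proof.
move=> Js; have e := collapse_energy Js.
have h : r ^+ 2 * m1 s ^+ 2 < 1.
  by apply: le_lt_trans rM; rewrite ler_pM2l ?exprn_gt0.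
rewrite lt0r dot_ge0 andbT; apply/eqP => k0; move: e; rewrite k0 mulr0 mul0r addr0.
by move=> e; rewrite e ltxx in h.
Qed.

Lemma collapse_wronskian s : J s -> m1 s ^+ 2 - m s * m2 s = 1 / r ^+ 2.
Proof.
move=> Js; have r0 : r ^+ 2 != 0 by rewrite expf_neq0 // gt_eqF.
apply: (mulfI r0); transitivity (1 : R); last by rewrite mulrCA divff // mulr1.
by rewrite -[RHS](collapse_energy Js) (collapse_m2 Js); field.
Qed.

Lemma is_derive_accel_sqr (s : R) :
  is_derive s 1 (fun t => dot (g2 t) (g2 t)) (2 * dot (g2 s) (g3 s)).
Proof.
apply: is_derive_ext (is_derive_dot (g2d s) (g2d s)) _ _ => //.
by rewrite (dotC (g3 s)); ring.
Qed.

(** Differentiate [collapse_energy]; by [collapse_m2] only the derivative of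
    [dot (g2 s) (g2 s)] survives. *)
Lemma collapse_accel_const s t : J s -> J t ->
  dot (g2 s) (g2 s) = dot (g2 t) (g2 t).
Proof.
apply: constant_on_interval iJ is_derive_accel_sqr _ => {t}s Js.
have h := derive0_on Js collapse_energy
  (is_derive_mul (is_derive_const ((r ^+ 2) : R) s)
    (is_derive_add (is_derive_mul (m1d s) (m1d s))
       (is_derive_mul (is_derive_mul (is_derive_mul (md s) (md s))
          (is_derive_accel_sqr s)) (is_derive_const ((4^-1) : R) s)))).
move: h; rewrite /= (collapse_m2 Js) => h.
have c0 : r ^+ 2 * m s ^+ 2 / 4 != 0.
  by rewrite mulf_neq0 ?invr_eq0 ?mulf_neq0 ?expf_neq0 ?gt_eqF.
by apply: (mulfI c0); rewrite mulr0 -[RHS]h; field.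
Qed.

Lemma collapse_position s : J s ->
  g s - (r ^+ 2 * (m s * m1 s)) *: g1 s + (r ^+ 2 * (m s * m s) / 2) *: g2 s = p.
Proof.
move=> Js; have [_ e] := collapse_flat Js; have h := collapse_slope Js.
have {}h : dot (p - g s) (g1 s) = - (r ^+ 2 * (m s * m1 s)).
  by move: h; rewrite /wslope constJ //; lra.
move: e; rewrite /normal_part h => e.
have -> : (r ^+ 2 * (m s * m s) / 2) *: g2 s
    = p - g s - - (r ^+ 2 * (m s * m1 s)) *: g1 s.
  apply: (@scalerI _ _ 2); first by rewrite pnatr_eq0.
  by rewrite e scalerA; congr (_ *: _); field.
by rewrite scaleNr opprK; apply/rowP => i; rewrite !mxE; ring.
Qed.

(** The derivative of [collapse_position], simplified by [collapse_m2] and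
    [collapse_energy]. *)
Lemma collapse_jerk s : J s -> g3 s + dot (g2 s) (g2 s) *: g1 s = 0.
Proof.
move=> Js.
have h := derive0_on Js collapse_position
  (is_derive_add (is_derive_sub (gd s)
    (is_derive_scale (is_derive_mul (is_derive_const ((r ^+ 2) : R) s)
       (is_derive_mul (md s) (m1d s))) (g1d s)))
    (is_derive_scale (is_derive_mul (is_derive_mul (is_derive_const ((r ^+ 2) : R) s)
       (is_derive_mul (md s) (md s))) (is_derive_const ((2^-1) : R) s)) (g2d s))).
have c0 : r ^+ 2 * m s ^+ 2 / 2 != 0.
  by rewrite mulf_neq0 ?invr_eq0 ?mulf_neq0 ?expf_neq0 ?gt_eqF.
apply: (scalerI c0); rewrite scaler0 -[RHS]h /= (collapse_m2 Js).
have e := collapse_energy Js; move: e; set k := dot _ _ => e.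
set E := r ^+ 2 * _ in e.
transitivity ((r ^+ 2 * m s ^+ 2 / 2) *: (g3 s + k *: g1 s) + (1 - E) *: g1 s).
  by rewrite e subrr scale0r addr0.
by rewrite /E; apply/rowP => i; rewrite !mxE; field.
Qed.

(** On [J] the weight solves [m'' = - (k / 2) ^ 2 m]; [c1] and [c2] are first
    integrals of this equation, and [collapse_energy] fixes [c1 ^ 2 + c2 ^ 2]. *)
Lemma collapse_cos (k : R) : 0 < k -> (forall s, J s -> dot (g2 s) (g2 s) = k ^+ 2) ->
  exists a : R, forall s, J s -> m s = 2 / (k * r) * cos (k * s / 2 + a).
Proof.
move=> k0 hk; pose w := k / 2.
have m2E s : J s -> m2 s = - (w ^+ 2 * m s).
  by move=> Js; rewrite (collapse_m2 Js) hk // /w; field.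
pose c1 s := w * m s * cos (w * s) - m1 s * sin (w * s).
pose c2 s := w * m s * sin (w * s) + m1 s * cos (w * s).
have d1 (s : R) : is_derive s 1 c1 (- ((w ^+ 2 * m s + m2 s) * sin (w * s))).
  apply: is_derive_ext (is_derive_sub (is_derive_mul (is_derive_mul
    (is_derive_const (w : R) s) (md s)) (is_derive_cosM w s))
    (is_derive_mul (m1d s) (is_derive_sinM w s))) _ _ => //=; ring.
have d2 (s : R) : is_derive s 1 c2 ((w ^+ 2 * m s + m2 s) * cos (w * s)).
  apply: is_derive_ext (is_derive_add (is_derive_mul (is_derive_mul
    (is_derive_const (w : R) s) (md s)) (is_derive_sinM w s))
    (is_derive_mul (m1d s) (is_derive_cosM w s))) _ _ => //=; ring.
have e1 s : J s -> c1 s = c1 x.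
  move=> Js; apply: (constant_on_interval iJ d1 _ Js Jx) => t Jt.
  by rewrite m2E // subrr mul0r oppr0.
have e2 s : J s -> c2 s = c2 x.
  move=> Js; apply: (constant_on_interval iJ d2 _ Js Jx) => t Jt.
  by rewrite m2E // subrr mul0r.
have [|a [ca sa]] := @cos_sin_surj R (r * c1 x) (- (r * c2 x)).
  rewrite -(collapse_energy Jx) hk // /c1 /c2 /w.
  have := cos2Dsin2 (k / 2 * x).
  set C := cos _; set S := sin _ => CS.
  transitivity (r ^+ 2 * (m1 x ^+ 2 + m x ^+ 2 * k ^+ 2 / 4) * (C ^+ 2 + S ^+ 2)).
    by field.
  by rewrite CS mulr1.
exists a => s Js.
have -> : k * s / 2 = w * s by rewrite /w; field.
rewrite cosD ca sa -(e1 s Js) -(e2 s Js) /c1 /c2.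
have := cos2Dsin2 (w * s); set C := cos _; set S := sin _ => CS.
transitivity (m s * (C ^+ 2 + S ^+ 2)); first by rewrite CS mulr1.
by rewrite /w; field; rewrite !gt_eqF.
Qed.

(** The center [c] and the frame [e1], [e2] are first integrals of the equation in
    [collapse_jerk]. *)
Lemma collapse_circle (k : R) : 0 < k ->
  (forall s, J s -> dot (g2 s) (g2 s) = k ^+ 2) -> circular_arc g k J.
Proof.
move=> k0 hk; have k_neq0 : k != 0 by rewrite gt_eqF.
have g3E s : J s -> g3 s = - k ^+ 2 *: g1 s.
  move=> Js; have := collapse_jerk Js; rewrite hk // scaleNr => /eqP.
  by rewrite addr_eq0 => /eqP.
pose e1 s := (- sin (k * s)) *: g1 s + (- (k^-1 * cos (k * s))) *: g2 s.
pose e2 s := cos (k * s) *: g1 s + (- (k^-1 * sin (k * s))) *: g2 s.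
pose c s := g s + (k ^- 2) *: g2 s.
pose z s := g3 s + k ^+ 2 *: g1 s.
have z0 s : J s -> z s = 0 by move=> Js; rewrite /z -(hk s Js) collapse_jerk.
have d1 (s : R) : is_derive s 1 e1 (- (k^-1 * cos (k * s)) *: z s).
  apply: is_derive_ext (is_derive_add
    (is_derive_scale (is_derive_mul (is_derive_const ((-1 : R) : R) s)
      (is_derive_sinM k s)) (g1d s))
    (is_derive_scale (is_derive_mul (is_derive_const ((- k^-1) : R) s)
      (is_derive_cosM k s)) (g2d s))) _ _ => [t|] /=.
    by rewrite mulN1r mulNr.
  by apply/rowP => i; rewrite !mxE; field.
have d2 (s : R) : is_derive s 1 e2 (- (k^-1 * sin (k * s)) *: z s).
  apply: is_derive_ext (is_derive_add
    (is_derive_scale (is_derive_cosM k s) (g1d s))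
    (is_derive_scale (is_derive_mul (is_derive_const ((- k^-1) : R) s)
      (is_derive_sinM k s)) (g2d s))) _ _ => [t|] /=.
    by rewrite mulNr.
  by apply/rowP => i; rewrite !mxE; field.
have d3 (s : R) : is_derive s 1 c (k ^- 2 *: z s).
  apply: is_derive_ext (is_derive_add (gd s)
    (is_derive_scale (is_derive_const ((k ^- 2) : R) s) (g2d s))) _ _ => //=.
  by apply/rowP => i; rewrite !mxE; field.
have cst_on (f : R -> 'rV[R]_n) (h : R -> R) : (forall s : R, is_derive s 1 f (h s *: z s)) ->
    forall s, J s -> f s = f x.
  move=> fd s Js; apply/rowP => i.
  apply: (@constant_on_interval _ J (fun t => f t 0 i) (fun t => (h t *: z t) 0 i)) iJ _ _ Js Jx.
    by move=> t; exact: is_derive_coord (fd t).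
  by move=> t Jt; rewrite z0 // scaler0 mxE.
have vg := velocity_accel g1d unit_speed x; have ux := unit_speed x.
have := hk x Jx; have := cos2Dsin2 (k * x) => CS kx.
exists (c x), (e1 x), (e2 x); split.
- rewrite /e1 !(dotDl, dotDr, dotZl, dotZr) (dotC (g2 x) (g1 x)) vg ux kx -[RHS]CS.
  by field.
- rewrite /e2 !(dotDl, dotDr, dotZl, dotZr) (dotC (g2 x) (g1 x)) vg ux kx -[RHS]CS.
  by field.
- rewrite /e1 /e2 !(dotDl, dotDr, dotZl, dotZr) (dotC (g2 x) (g1 x)) vg ux kx.
  by field.
move=> s Js; rewrite -(cst_on _ _ d1 s Js) -(cst_on _ _ d2 s Js) -(cst_on _ _ d3 s Js).
have := cos2Dsin2 (k * s); rewrite /c /e1 /e2.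
set C := cos _; set S := sin _ => {}CS.
apply/rowP => i; rewrite !mxE.
transitivity (g s 0 i + (1 - (C ^+ 2 + S ^+ 2)) / k ^+ 2 * g2 s 0 i); last by field.
by rewrite CS subrr !mul0r addr0.
Qed.

End Collapse.

(** * Closed curves and components *)

Section Periodic.
Variables (R : realType) (L : R).
Hypothesis L_gt0 : 0 < L.

Lemma periodic_int (T : Type) (f : R -> T) : (forall s, f (s + L) = f s) ->
  forall (k : int) s, f (s + k%:~R * L) = f s.
Proof.
move=> fL.
have nat_case (j : nat) s : f (s + j%:R * L) = f s.
  elim: j s => [|j IH] s; first by rewrite mul0r addr0.
  by rewrite -natr1 mulrDl mul1r addrA fL IH.
case=> [j s|j s]; first exact: nat_case.
by rewrite NegzE mulrNz mulNr -(nat_case j.+1) subrK.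
Qed.

Lemma reduce_period (a s : R) : exists k : int, a <= s + k%:~R * L < a + L.
Proof.
exists (- Num.floor ((s - a) / L)).
have /andP[h1 h2] := floor_itv ((s - a) / L); move: h1 h2.
rewrite mulrNz intrD; set k := _%:~R => h1 h2.
rewrite ler_pdivlMr // in h1; rewrite ltr_pdivrMr // in h2.
by apply/andP; split; lra.
Qed.

Lemma periodic_bounded (f : R -> R) : continuous f -> (forall s, f (s + L) = f s) ->
  has_ubound (range f).
Proof.
move=> cf fL; have [|c _ hc] := @EVT_max _ f 0 L (ltW L_gt0).
  exact: continuous_subspaceT.
exists (f c) => _ [s _ <-]; have [k hk] := reduce_period 0 s.
rewrite -(periodic_int fL k s); apply: hc; rewrite in_itv /=.
by move: hk; rewrite add0r => /andP[-> /ltW].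
Qed.

Lemma is_derive_translate (V : normedModType R) (f : R -> V) (d : V) (s c : R) :
  is_derive (s + c) 1 f d -> is_derive s 1 (fun t => f (t + c)) d.
Proof.
move=> [df dE].
have e : (fun h : R => h^-1 *: (((fun t => f (t + c)) \o shift s) (h *: 1) - f (s + c)))
   = (fun h : R => h^-1 *: ((f \o shift (s + c)) (h *: 1) - f (s + c))).
  by apply/funext => h; rewrite /= addrA.
by apply: DeriveDef; [rewrite /derivable e | rewrite /derive e].
Qed.

Lemma periodic_derive (V : normedModType R) (f df : R -> V) :
  (forall s : R, is_derive s 1 f (df s)) -> (forall s, f (s + L) = f s) ->
  forall s, df (s + L) = df s.
Proof.
move=> fd fL s; apply: is_derive_uniq (fd s).
by apply: is_derive_ext (is_derive_translate (fd (s + L))) _ _.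
Qed.

End Periodic.

Lemma class_C_is_derive (R : realType) (V : normedModType R) (k j : nat)
    (f : R -> V) : class_C k f -> (j < k)%N ->
  forall s : R, is_derive s 1 (f^`(j)) (f^`(j.+1) s).
Proof.
by move=> [df _] jk s; rewrite derive1nS derive1E; apply: derivableP; exact: df.
Qed.

Section ClosedCurve.
Variables (R : realType) (n : nat) (gamma : R -> 'rV[R]_n) (L : R).
Hypothesis curve : closed_curve gamma L.

Let L_gt0 : 0 < L. Proof. by case: curve. Qed.

Lemma curve_derive k (s : R) : is_derive s 1 (gamma^`(k)) (gamma^`(k.+1) s).
Proof. by case: curve => _ sm _ _ _; exact: class_C_is_derive (sm k.+1) _ _. Qed.

Lemma curve_continuous : continuous gamma.
Proof. by move=> s; exact: is_derive_cont (curve_derive 0 s). Qed.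

Lemma curve_unit s : dot (gamma^`()%classic s) (gamma^`()%classic s) = 1.
Proof. by case: curve => _ _ h _ _; exact: enorm_eq1. Qed.

Lemma curve_periodic k s : gamma^`(k) (s + L) = gamma^`(k) s.
Proof.
elim: k s => [|k IH] s; first by case: curve.
exact: periodic_derive (curve_derive k) IH s.
Qed.

Lemma curve_periodic_int (k : int) s : gamma (s + k%:~R * L) = gamma s.
Proof. exact: periodic_int (curve_periodic 0) k s. Qed.

Lemma curve_inj s t : gamma s = gamma t -> exists k : int, t = s + k%:~R * L.
Proof.
have [k1 h1] := reduce_period L_gt0 0 s; have [k2 h2] := reduce_period L_gt0 0 t.
rewrite -(curve_periodic_int k1 s) -(curve_periodic_int k2 t) add0r in h1 h2 *.
case: curve => _ _ _ _ inj /(inj _ _ h1 h2) e; exists (k1 - k2).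
by rewrite intrB mulrBl; lra.
Qed.

Lemma curve_inj_lt a s t : a <= s < a + L -> a <= t < a + L ->
  gamma s = gamma t -> s = t.
Proof.
move=> hs ht /curve_inj[k e].
suff k0 : k = 0 by rewrite e k0 mul0r addr0.
have h1 : k%:~R * L < 1 * L by lra.
have h2 : -1 * L < k%:~R * L by lra.
rewrite ltr_pM2r // in h1; rewrite ltr_pM2r // in h2.
by move: h1 h2; rewrite -[1]/(1%:~R) -[-1]/((-1)%:~R) !ltr_int {e}; case: k => [[|j]|[|j]].
Qed.

Lemma range_curve a : range gamma = gamma @` `[a, a + L].
Proof.
apply/seteqP; split => [_ [s _ <-]|_ [s _ <-]]; last by exists s.
have [k hk] := reduce_period L_gt0 a s; exists (s + k%:~R * L).
  by rewrite /= in_itv /=; case/andP: hk => -> /ltW.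
exact: curve_periodic_int.
Qed.

Lemma range_curve_compact : compact (range gamma).
Proof.
rewrite (range_curve 0); apply: continuous_compact; last exact: segment_compact.
exact/continuous_subspaceT/curve_continuous.
Qed.

Lemma range_curve_closed : closed (range gamma).
Proof. by apply: compact_closed range_curve_compact; exact: norm_hausdorff. Qed.

Lemma range_curve_connected : connected (range gamma).
Proof.
apply: connected_continuous_connected.
  by apply/connected_intervalP => x y _ _ z _.
exact/continuous_subspaceT/curve_continuous.
Qed.

End ClosedCurve.

Section Components.
Variables (R : realType) (n : nat) (K : set 'rV[R]_n).
Hypothesis hK : union_of_closed_curves K.

(** The curves are compact, pairwise disjoint and finite in number, so each is both
    open and closed in [K]. *)
Lemma component_exists q : K q -> exists (gamma : R -> 'rV[R]_n) (L : R),
  [/\ closed_curve gamma L, range gamma = connected_component K q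
    & range gamma q].
Proof.
case: hK => m [gam [L [cc tI KE]]] Kq.
have [i _ qi] : (\bigcup_(i in [set: 'I_m]) range (gam i)) q by rewrite -KE.
exists (gam i), (L i); split => //.
have subK : range (gam i) `<=` K by rewrite KE => x hx; exists i.
apply/seteqP; split.
  by apply: connected_component_max => //; exact: (range_curve_connected (cc i)).
set C := connected_component K q.
have CK : C `<=` K by exact: connected_component_sub.
have cC : connected C by exact: component_connected.
have Cq : C q by exact: connected_component_refl.
have <- : C `&` range (gam i) = C; last by move=> x [].
apply: cC; first by exists q.
  exists (~` \bigcup_(j in [set j : 'I_m | j != i]) range (gam j)).
    apply: closed_openC; apply: closed_bigcup => [|j _]; first exact: finite_finset.
    exact: (range_curve_closed (cc j)).
  apply/seteqP; split => x [Cx hx]; split => //.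
    move=> [j /= ji hj]; move/eqP: ji; apply.
    by apply: (tI j i) => //; exists x.
  have [j _ hj] : (\bigcup_(i in [set: 'I_m]) range (gam i)) x.
    by rewrite -KE; exact: CK.
  have [<-//|ji] := eqVneq j i.
  by case: hx; exists j.
by exists (range (gam i)) => //; exact: (range_curve_closed (cc i)).
Qed.

Lemma component_param_exists q : K q -> exists (gamma : R -> 'rV[R]_n) (L s : R),
  [/\ component_param K gamma L, gamma s = q
    & range gamma = connected_component K q].
Proof.
move=> Kq; have [gamma [L [cc rE [s _ sq]]]] := component_exists Kq.
by exists gamma, L, s; split => //; split => //; exists q.
Qed.

End Components.

Lemma param_range (R : realType) (n : nat) (K : set 'rV[R]_n) gamma L s :
  component_param K gamma L -> range gamma = connected_component K (gamma s).
Proof.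
move=> [_ [q _ rE]]; rewrite rE; apply: same_connected_component.
by rewrite -rE; exists s.
Qed.

Lemma param_in (R : realType) (n : nat) (K : set 'rV[R]_n) gamma L s :
  component_param K gamma L -> K (gamma s).
Proof.
move=> [_ [q _ rE]]; apply: (@connected_component_sub _ K q).
by rewrite -rE; exists s.
Qed.

(** * Change of parametrization *)

Section Reparametrization.
Variables (R : realType) (n : nat) (gamma delta : R -> 'rV[R]_n) (L L' : R).
Hypotheses (cg : closed_curve gamma L) (cd : closed_curve delta L').
Hypothesis same_range : range gamma = range delta.
Variables s t : R.
Hypothesis same_point : gamma s = delta t.

(** A closed curve is a homeomorphism from the circle onto its range, so [delta]
    near [t] lifts to [gamma] near [s]. *)
Lemma reparametrization : exists k : R -> R,
  k @ 0^' --> 0^' /\ forall h, gamma (k h + s) = delta (h + t).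
Proof.
have L0 : 0 < L by case: cg.
have L0' : 0 < L' by case: cd.
have /choice[k hk] : forall h, exists u,
    - (L / 2) <= u < L / 2 /\ gamma (u + s) = delta (h + t).
  move=> h; have : range gamma (delta (h + t)) by rewrite same_range; exists (h + t).
  move=> [x _ hx]; have [j hj] := reduce_period L0 (s - L / 2) x.
  exists (x + j%:~R * L - s); split; first lra.
  by rewrite subrK (curve_periodic_int cg).
exists k; split; last by move=> h; case: (hk h).
move=> A /nbhs_ballP[e /= e0 hA].
pose C := `[s - L / 2, s + L / 2] `&` ~` ball s e.
have cC : closed (gamma @` C).
  apply: compact_closed; first exact: norm_hausdorff.
  apply: continuous_compact.
    exact/continuous_subspaceT/(curve_continuous cg).
  apply: compact_closedI; first exact: segment_compact.
  by apply: open_closedC; exact: ball_open.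
have cdt : {for t, continuous delta} by exact: (curve_continuous cd).
have nC : (~` (gamma @` C)) (delta t).
  move=> [x [/= xs xe]]; rewrite -same_point => gx; apply: xe.
  rewrite in_itv /= in xs.
  have -> : x = s; last exact: ballxx.
  have [j ej] := curve_inj cg gx.
  have [xs'|xs'] := eqVneq x (s + L / 2).
    by apply: (curve_inj_lt cg (a := s)) => //; lra.
  have {}xs' : x < s + L / 2 by rewrite lt_neqAle xs' /=; case/andP: xs.
  by apply: (curve_inj_lt cg (a := s - L / 2)) => //; lra.
have /near_ball[d d0 hd] : \forall x \near t, (~` (gamma @` C)) (delta x).
  by apply: cdt; apply: open_nbhs_nbhs; split => //; exact: closed_openC.
apply/nbhs_ballP; exists (Num.min d L'); first by rewrite /= lt_min d0.
move=> h; rewrite /ball /= sub0r normrN lt_min => /andP[h1 h2] h0.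
have [k1 k2] := hk h; apply: hA; rewrite /ball /=.
  rewrite sub0r normrN ltNge; apply/negP => he; apply: (hd (h + t)).
    by rewrite addrK.
  exists (k h + s) => //; split; first by rewrite /= in_itv /=; lra.
  by rewrite /ball /= opprD addrA addrAC subrr sub0r normrN ltNge he.
apply/eqP => k0; move: k2; rewrite k0 add0r same_point.
move: h2; rewrite ltr_norml => h2; have [h3|h3] := leP 0 h => e1.
  have : t = h + t by apply: (curve_inj_lt cd (a := t)) => //; lra.
  by move=> e2; case/negP: h0; apply/eqP; lra.
have : t = h + t by apply: (curve_inj_lt cd (a := h + t)) => //; lra.
by move=> e2; case/negP: h0; apply/eqP; lra.
Qed.

(** Difference quotients along [delta] are those along [gamma] at the lifted
    increment [k h], times [k h / h].  Applied to the curves themselves this shows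
    that [k h / h] converges, and unit speed that the limit is a sign. *)
Lemma reparam_derive : exists2 e : R, e ^+ 2 = 1 &
  forall (V : normedModType R) (f : 'rV[R]_n -> V) (a b : V),
    is_derive s 1 (f \o gamma) a -> is_derive t 1 (f \o delta) b -> b = e *: a.
Proof.
have [k [k0 kE]] := reparametrization.
pose rho h := h^-1 * k h.
have quot (V : normedModType R) (f : 'rV[R]_n -> V) (a b : V) :
    is_derive s 1 (f \o gamma) a -> is_derive t 1 (f \o delta) b ->
    exists2 B : R -> V, B @ 0^' --> a & (fun h => rho h *: B h) @ 0^' --> b.
  move=> [da <-] [db <-].
  exists (fun h => (k h)^-1 *: (f (gamma (k h + s)) - f (gamma s))).
    apply: cvg_trans (cvg_comp _ _ k0 da).
    apply: near_eq_cvg; apply: nearW => h /=.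
    by rewrite [_ *: 1]mulr1.
  have kn0 : \forall h \near 0^', k h != 0.
    by apply: (k0 [set x : R | x != 0]); apply/nbhs_ballP; exists 1 => /=.
  apply: cvg_trans db; apply: near_eq_cvg.
  near=> h; have kh : k h != 0 by near: h.
  rewrite /= [_ *: 1]mulr1 kE same_point /rho scalerA -mulrA divff // mulr1.
  by [].
have [ug ud] := (curve_unit cg s, curve_unit cd t).
have dg : is_derive s 1 (id \o gamma) (gamma^`()%classic s) := curve_derive cg 0 s.
have dd : is_derive t 1 (id \o delta) (delta^`()%classic t) := curve_derive cd 0 t.
move: ug ud dg dd; set g1 := _ s; set d1 := _ t => ug ud dg dd.
have [B hB hA] := quot _ id _ _ dg dd.
have cdot (A : R -> 'rV[R]_n) a : A @ 0^' --> a -> (fun h => dot (A h) g1) @ 0^' --> dot a g1.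
  move=> hA'; have hc : {for a, continuous (fun v => dot v g1)}.
    by apply: dot_continuous; [exact: cvg_id | exact: cst_continuous].
  exact: (@cvg_comp _ _ _ A (fun v => dot v g1) _ _ _ hA' hc).
have rho_cvg : rho @ 0^' --> dot d1 g1.
  have h1 := cdot _ _ hB; have h2 := cdot _ _ hA.
  rewrite ug in h1.
  have h3 : (fun h => (dot (rho h *: B h) g1) / dot (B h) g1) @ 0^' --> dot d1 g1.
    rewrite -[X in _ --> X](divr1 (dot d1 g1)).
    by apply: cvgM => //; apply: cvgV => //; exact: oner_neq0.
  have Bpos : \forall h \near 0^', 0 < dot (B h) g1.
    apply: (h1 [set x | 0 < x]); apply: open_nbhs_nbhs.
    by split; [exact: open_gt | exact: ltr01].
  apply: cvg_trans h3; apply: near_eq_cvg.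
  near=> h; have hB0 : 0 < dot (B h) g1 by near: h.
  by rewrite dotZl mulfK // gt_eqF.
have scal (V : normedModType R) (f : 'rV[R]_n -> V) (a b : V) :
    is_derive s 1 (f \o gamma) a -> is_derive t 1 (f \o delta) b ->
    b = dot d1 g1 *: a.
  move=> da db; have [B' hB' hA'] := quot _ _ _ _ da db.
  by apply: (cvg_unique _ hA') => //; exact: (cvgZ rho_cvg hB').
have e := scal _ _ _ _ dg dd; exists (dot d1 g1) => //.
by rewrite -[RHS]ud [in RHS]e dotZl dotZr ug mulr1 expr2.
Unshelve. all: by end_near.
Qed.

End Reparametrization.

(** * Gradient, focal radius and exponential map *)

(** Another parametrization changes both factors by the same sign. *)
Lemma grad_param (R : realType) (n : nat) (K : set 'rV[R]_n) (mu : 'rV[R]_n -> R)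
    (gamma : R -> 'rV[R]_n) (L s : R) :
  class_C_on 3 K mu -> component_param K gamma L ->
  grad K mu (gamma s) =
    (mu \o gamma)^`()%classic s *: gamma^`()%classic s.
Proof.
move=> mu_C3 hp; rewrite /grad; case: xgetP => [g _ [delta [L' [t [hd ts ->]]]]|].
  have cd := hd.1; have cg := hp.1.
  have rE : range gamma = range delta.
    by rewrite (param_range s hp) (param_range t hd) ts.
  have [e e1 he] := reparam_derive cg cd rE (esym ts).
  have dm : forall delta L', component_param K delta L' -> forall u : R,
      is_derive u 1 (mu \o delta) ((mu \o delta)^`()%classic u).
    by move=> d l hd' u; exact: (@class_C_is_derive R _ 3 0 (mu \o d) (mu_C3 _ _ hd') isT u).
  have -> := he _ mu _ _ (dm _ _ hp s) (dm _ _ hd t).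
  have -> : delta^`()%classic t = e *: gamma^`()%classic s.
    exact: he _ id _ _ (curve_derive cg 0 s) (curve_derive cd 0 t).
  by rewrite scalerA mulrAC -expr2 e1 mul1r.
move=> h; exfalso.
by apply: (h ((mu \o gamma)^`()%classic s *: gamma^`()%classic s)); exists gamma, L, s.
Qed.

Section Component.
Variables (R : realType) (n : nat) (K : set 'rV[R]_n) (mu : 'rV[R]_n -> R).
Hypothesis mu_gt0 : forall q : 'rV[R]_n, K q -> 0 < mu q.
Hypothesis mu_C3 : class_C_on 3 K mu.
Variables (gamma : R -> 'rV[R]_n) (L : R).
Hypothesis param : component_param K gamma L.

Let curve : closed_curve gamma L := param.1.
Let g1 : R -> 'rV[R]_n := gamma^`()%classic.
Let g2 : R -> 'rV[R]_n := gamma^`(2)%classic.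
Let m : R -> R := mu \o gamma.
Let m1 : R -> R := m^`()%classic.
Let m2 : R -> R := m^`(2)%classic.
Let L_gt0 : 0 < L. Proof. by case: curve. Qed.

Lemma curve_d0 (s : R) : is_derive s 1 gamma (g1 s).
Proof. exact: (curve_derive curve 0 s). Qed.

Lemma curve_d1 (s : R) : is_derive s 1 g1 (g2 s).
Proof. exact: (curve_derive curve 1 s). Qed.

Lemma curve_d2 (s : R) : is_derive s 1 g2 (gamma^`(3)%classic s).
Proof. exact: (curve_derive curve 2 s). Qed.

Lemma weight_derive j (s : R) : (j < 3)%N -> is_derive s 1 (m^`(j))%classic ((m^`(j.+1))%classic s).
Proof. by move=> j3; apply: class_C_is_derive j3 s; exact: mu_C3 param. Qed.

Lemma weight_d0 (s : R) : is_derive s 1 m (m1 s).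
Proof. exact: (@weight_derive 0). Qed.

Lemma weight_d1 (s : R) : is_derive s 1 m1 (m2 s).
Proof. exact: (@weight_derive 1). Qed.

Lemma accel_cont : continuous g2.
Proof. by move=> s; exact: is_derive_cont (curve_d2 s). Qed.

Lemma weight2_cont : continuous m2.
Proof.
by move=> s; exact: is_derive_cont (@weight_derive 2 s isT).
Qed.

Lemma weight_gt0 s : 0 < m s.
Proof. exact: mu_gt0 (param_in s param). Qed.

Lemma weight_periodic s : m (s + L) = m s.
Proof. by congr mu; exact: (curve_periodic curve 0). Qed.

Lemma weight1_periodic s : m1 (s + L) = m1 s.
Proof. exact: periodic_derive weight_d0 weight_periodic s. Qed.

Lemma weight2_periodic s : m2 (s + L) = m2 s.
Proof. exact: periodic_derive weight_d1 weight1_periodic s. Qed.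

Lemma curvature_sqr s : curvature gamma s ^+ 2 = dot (g2 s) (g2 s).
Proof. exact: enorm_sqr. Qed.

Lemma discrE s : discr mu gamma s = disc g2 m m2 s.
Proof. by rewrite /discr curvature_sqr. Qed.

Lemma LambdaE s : Lambda mu gamma s = focal g2 m m1 m2 s.
Proof.
rewrite /Lambda discrE curvature_sqr.
have d1 (t : R) : is_derive t 1 (fun t => mu (gamma t) ^+ 2) (2 * (m t * m1 t)).
  by apply: is_derive_ext (is_derive_mul (weight_d0 t) (weight_d0 t)) _ _ => //; ring.
have d2 : is_derive s 1 (fun t => 2 * (m t * m1 t)) (2 * (m1 s ^+ 2 + m s * m2 s)).
  apply: is_derive_ext (is_derive_mul (is_derive_const (2 : R) s)
    (is_derive_mul (weight_d0 s) (weight_d1 s))) _ _ => //=; ring.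
have -> : ((fun t => mu (gamma t) ^+ 2)^`(2))%classic s = 2 * (m1 s ^+ 2 + m s * m2 s).
  rewrite derive1nS derive1n1.
  have -> : ((fun t => mu (gamma t) ^+ 2)^`())%classic = (fun t => 2 * (m t * m1 t)).
    by apply/funext => t; rewrite derive1E; case: (d1 t).
  by rewrite derive1E; case: d2.
by rewrite /focal -/(enorm _) /curvature -/g2 /m /=; field.
Qed.

Definition focal_bound : R := Num.max
  (sup [set Lambda mu gamma s | s in [set s : R | 0 < discr mu gamma s]])
  (sup (range (fun s : R => `|(mu \o gamma)^`()%classic s| ^+ 2))).

(** [Lambda] and [discr] are [focal] and [disc] of the curve, and the supremum is
    finite because they are continuous and periodic. *)
Lemma focal_le_bound s : 0 < disc g2 m m2 s -> focal g2 m m1 m2 s <= focal_bound.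
Proof.
rewrite -discrE -LambdaE => ds; rewrite le_max; apply/orP; left.
apply: ub_le_sup; last by exists s.
have cf := focal_continuous accel_cont weight_d0 weight_d1 weight2_cont.
have [B hB] : has_ubound (range (focal g2 m m1 m2)).
  apply: (periodic_bounded L_gt0 cf) => t.
  rewrite /focal /disc weight_periodic weight1_periodic weight2_periodic.
  by rewrite /g2 (curve_periodic curve 2).
by exists B => _ [t _ <-]; rewrite LambdaE; apply: hB; exists t.
Qed.

Lemma slope_le_bound s : m1 s ^+ 2 <= focal_bound.
Proof.
rewrite le_max; apply/orP; right; rewrite -real_normK ?num_real //.
apply: ub_le_sup; last by exists s.
have c1 : continuous m1 by move=> t; exact: is_derive_cont (weight_d1 t).
have [||B hB] := periodic_bounded L_gt0 (f := fun t => m1 t * m1 t).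
- by move=> t; apply: cont_mul; exact: c1.
- by move=> t; rewrite weight1_periodic.
by exists B => _ [t _ <-]; rewrite real_normK ?num_real //; apply: hB; exists t.
Qed.

Lemma FocRad_lt r : 0 <= r -> r < FocRad K mu -> r ^+ 2 * focal_bound < 1.
Proof.
move=> r0 rF; have rC : r < FocRad_curve mu gamma.
  apply: lt_le_trans rF _; apply: ge_inf; last by exists gamma, L.
  by exists 0 => _ [d [l [_ ->]]]; rewrite invr_ge0 sqrtr_ge0.
have M0 : 0 <= focal_bound by apply: le_trans (slope_le_bound 0); exact: sqr_ge0.
move: rC; rewrite /FocRad_curve -/focal_bound => rC.
have s0 : 0 < Num.sqrt focal_bound by rewrite -invr_gt0 (le_lt_trans r0).
rewrite -(sqr_sqrtr M0) -exprMn exprn_ilt1 //.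
  by rewrite mulr_ge0 // ltW.
by rewrite -ltr_pdivlMr // div1r.
Qed.

(** The tangential part [- mu |w| ^ 2 grad mu] of the exponential is the one that
    makes [s] critical, and the square root makes the weighted distance [r]. *)
Lemma expmu_critical (p v : 'rV[R]_n) (r s : R) :
  0 <= r -> r ^+ 2 * focal_bound < 1 ->
  enorm v = 1 -> dot v (g1 s) = 0 -> expmu K mu (gamma s) (r *: v) = p ->
  [/\ wdist2 gamma m p s = r ^+ 2, wslope gamma g1 m m1 p s = 0 &
    normal_part gamma g1 p s = (m s * Num.sqrt (1 - r ^+ 2 * m1 s ^+ 2) * r) *: v].
Proof.
move=> r0 rM /enorm_eq1 v1 vg; rewrite /expmu (grad_param s mu_C3 param).
rewrite !enorm_sqr !(dotZl, dotZr) v1 (curve_unit curve) !mulr1 scalerA -!expr2.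
rewrite -/m1 -/g1 -[mu (gamma s)]/(m s) (mulrC (m1 s ^+ 2)).
have c0 : 0 <= 1 - r ^+ 2 * m1 s ^+ 2.
  rewrite subr_ge0 ltW //; apply: le_lt_trans rM.
  by rewrite ler_wpM2l ?sqr_ge0 // slope_le_bound.
have := sqr_sqrtr c0; set c := Num.sqrt _ => cE pE.
have u : p - gamma s = (m s * c * r) *: v - (m s * r ^+ 2 * m1 s) *: g1 s.
  by rewrite -pE scalerA; apply/rowP => i; rewrite !mxE; ring.
have ug : dot (p - gamma s) (g1 s) = - (m s * r ^+ 2 * m1 s).
  by rewrite u dotDl dotNl !dotZl vg (curve_unit curve) mulr0 mulr1 sub0r.
have m0 := weight_gt0 s.
have w : wdist2 gamma m p s = r ^+ 2.
  rewrite /wdist2 u !(dotDl, dotDr, dotNl, dotNr, dotZl, dotZr) (dotC (g1 s) v).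
  rewrite vg v1 (curve_unit curve); apply: (canLR (mulfK _)).
    by rewrite expf_neq0 // gt_eqF.
  transitivity (m s ^+ 2 * c ^+ 2 * r ^+ 2 + m s ^+ 2 * r ^+ 4 * m1 s ^+ 2); first by ring.
  by rewrite cE; ring.
split=> //; first by rewrite /wslope ug w; ring.
by rewrite /normal_part ug u scaleNr opprK subrK.
Qed.

(** The energy equation says that the square root in [expmu] is half of [r] times
    the weight times the curvature. *)
Lemma expmu_collapse (p : 'rV[R]_n) (r s : R) : 0 < r ->
  gamma s - (r ^+ 2 * (m s * m1 s)) *: g1 s + (r ^+ 2 * (m s * m s) / 2) *: g2 s = p ->
  r ^+ 2 * (m1 s ^+ 2 + m s ^+ 2 * dot (g2 s) (g2 s) / 4) = 1 ->
  0 < dot (g2 s) (g2 s) ->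
  expmu K mu (gamma s) (r *: principal_normal gamma s) = p.
Proof.
move=> r0 pE e k0; rewrite /expmu (grad_param s mu_C3 param) /principal_normal.
rewrite !enorm_sqr !(dotZl, dotZr) (curve_unit curve) !mulr1 !scalerA.
rewrite -/m1 -/g1 -/g2 -[mu (gamma s)]/(m s).
have kpos : 0 < curvature gamma s by rewrite sqrtr_gt0.
have kE := curvature_sqr s; move: e pE kpos kE; rewrite -/g2.
set k := curvature gamma s => e pE kpos kE.
have k1 : k^-1 * (k^-1 * dot (g2 s) (g2 s)) = 1 by rewrite -kE; field; rewrite gt_eqF.
rewrite k1 mulr1.
have -> : 1 - m1 s * m1 s * (r * r) = (r * m s * k / 2) ^+ 2.
  by move: e; rewrite -kE => e; lra.
have m0 := weight_gt0 s.
rewrite sqrtr_sqr gtr0_norm; last by rewrite !mulr_gt0 // invr_gt0.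
rewrite -pE; apply/rowP => i; rewrite !mxE; field.
by rewrite gt_eqF.
Qed.

Lemma principal_normal_unit s v (a : R) : 0 < a -> enorm v = 1 ->
  a *: v = g2 s -> v = principal_normal gamma s.
Proof.
move=> a0 v1 e; rewrite /principal_normal /curvature -/g2 -e.
have -> : enorm (a *: v) = a.
  by rewrite /enorm !(dotZl, dotZr) (enorm_eq1 v1) mulr1 -expr2 sqrtr_sqr gtr0_norm.
by rewrite scalerA mulVf ?scale1r // gt_eqF.
Qed.

End Component.

(** * Double critical pairs *)

Section LocalMinimum.
Variables (R : realType) (V : normedModType R).

Lemma local_min_diff0 (f : V -> R) (x : V) : differentiable f x ->
  (\forall y \near x, f x <= f y) -> is_diff x f (cst 0).
Proof.
move=> df fmin; apply: DiffDef => //; apply/funext => v /=.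
rewrite -(deriveE v df).
have := diff_derivable (v := v) df; set D := derive f x v => dv.
pose q h := h^-1 *: ((f \o shift x) (h *: v) - f x).
have qD : q @ 0^' --> D by exact: dv.
have near0 : \forall h \near 0^', f x <= f (h *: v + x).
  have c : (fun h : R => h *: v + x) @ 0^' --> x.
    rewrite -[X in _ --> X](add0r x) -[X in X + _](scale0r v).
    apply: cvgD; last exact: cvg_cst.
    by apply: cvgZ; [exact: nbhs_dnbhs | exact: cvg_cst].
  exact: (c _ fmin).
have dnbhs_ball (P : R -> Prop) : (\forall h \near 0^', P h) ->
    exists2 e, 0 < e & P e /\ P (- e).
  move=> /nbhs_ballP[e /= e0 hP]; exists (e / 2); first by rewrite divr_gt0.
  have e2 : `|e / 2| < e by rewrite gtr0_norm ?divr_gt0 //; lra.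
  by split; apply: hP; rewrite /ball /= ?oppr_eq0 ?sub0r ?normrN // gt_eqF ?divr_gt0.
have [D0|D0|//] := ltgtP D 0.
  have /dnbhs_ball[e e0 [[h1 h2] _]] : \forall h \near 0^', q h < 0 /\ f x <= f (h *: v + x).
    apply: filterS2 near0 (qD [set y | y < 0] _) => [h h1 h2 //|].
    by apply: open_nbhs_nbhs; split; [exact: (@open_lt R 0)|].
  move: h1; rewrite /q /= pmulr_rlt0 ?invr_gt0 // subr_lt0.
  by rewrite ltNge h2.
have /dnbhs_ball[e e0 [_ [h1 h2]]] : \forall h \near 0^', 0 < q h /\ f x <= f (h *: v + x).
  apply: filterS2 near0 (qD [set y | 0 < y] _) => [h h1 h2 //|].
  by apply: open_nbhs_nbhs; split; [exact: (@open_gt R 0)|].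
move: h1; rewrite /q /= nmulr_rgt0 ?invr_lt0 ?oppr_lt0 // subr_lt0.
by rewrite ltNge h2.
Qed.

End LocalMinimum.

Lemma differentiable_dot (R : realType) (V : normedModType R) (n : nat)
    (f g : V -> 'rV[R]_n) (x : V) :
  differentiable f x -> differentiable g x ->
  differentiable (fun y => dot (f y) (g y)) x.
Proof.
move=> df dg.
have -> : (fun y => dot (f y) (g y)) =
    \sum_(i < n) ((fun y => f y 0 i) * (fun y => g y 0 i)).
  by apply/funext => y; rewrite fct_sumE.
apply: differentiable_sum => i; apply: differentiableM.
  exact: (differentiable_comp df (differentiable_coord (f x) 0 i)).
exact: (differentiable_comp dg (differentiable_coord (g x) 0 i)).
Qed.

Section Sigma.
Variables (R : realType) (n : nat) (K : set 'rV[R]_n) (mu : 'rV[R]_n -> R).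
Hypothesis mu_gt0 : forall q : 'rV[R]_n, K q -> 0 < mu q.
Hypothesis mu_C3 : class_C_on 3 K mu.
Variables (gamma1 gamma2 : R -> 'rV[R]_n) (L1 L2 : R).
Hypothesis param1 : component_param K gamma1 L1.
Hypothesis param2 : component_param K gamma2 L2.

Lemma differentiable_fst_comp (V : normedModType R) (f : R -> V) (d : V) (x : R * R) :
  is_derive x.1 1 f d -> differentiable (fun y : R * R => f y.1) x.
Proof.
move=> [df _]; apply: (@differentiable_comp _ _ _ _ fst f).
  by apply: linear_differentiable => y; exact: cvg_fst.
exact/derivable1_diffP.
Qed.

Lemma differentiable_snd_comp (V : normedModType R) (f : R -> V) (d : V) (x : R * R) :
  is_derive x.2 1 f d -> differentiable (fun y : R * R => f y.2) x.
Proof.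
move=> [df _]; apply: (@differentiable_comp _ _ _ _ snd f).
  by apply: linear_differentiable => y; exact: cvg_snd.
exact/derivable1_diffP.
Qed.

Lemma Sigma_differentiable (x : R * R) :
  differentiable (fun st : R * R => Sigma mu (gamma1 st.1) (gamma2 st.2)) x.
Proof.
have d1 := differentiable_fst_comp (curve_d0 param1 x.1).
have d2 := differentiable_snd_comp (curve_d0 param2 x.2).
have e1 := differentiable_fst_comp (weight_d0 mu_C3 param1 x.1).
have e2 := differentiable_snd_comp (weight_d0 mu_C3 param2 x.2).
have m1 := weight_gt0 mu_gt0 param1 x.1; have m2 := weight_gt0 mu_gt0 param2 x.2.
have -> : (fun st : R * R => Sigma mu (gamma1 st.1) (gamma2 st.2)) =
  (fun st => dot (gamma1 st.1 - gamma2 st.2) (gamma1 st.1 - gamma2 st.2)) *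
  (fun st => ((mu (gamma1 st.1) + mu (gamma2 st.2)) ^+ 2)^-1).
  by apply/funext => st; rewrite /Sigma enorm_sqr.
apply: differentiableM.
  by apply: differentiable_dot; exact: differentiableB.
apply: differentiableV; last by rewrite expf_neq0 // gt_eqF // addr_gt0.
by have h := differentiableD e1 e2; exact: (differentiableM h h).
Qed.

Lemma Sigma_local_min_ge s t :
  gamma1 s <> gamma2 t ->
  (\forall x \near (s, t), Sigma mu (gamma1 s) (gamma2 t)
     <= Sigma mu (gamma1 x.1) (gamma2 x.2)) ->
  half_DCSD K mu <= Num.sqrt (Sigma mu (gamma1 s) (gamma2 t)).
Proof.
move=> neq smin.
have h : double_critical_pair K mu (gamma1 s) (gamma2 t).
  split => //; exists gamma1, gamma2, L1, L2, s, t; split => //.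
  by apply: local_min_diff0; [exact: Sigma_differentiable|].
have m1 := weight_gt0 mu_gt0 param1 s; have m2 := weight_gt0 mu_gt0 param2 t.
have -> : Num.sqrt (Sigma mu (gamma1 s) (gamma2 t)) =
    enorm (gamma1 s - gamma2 t) / (mu (gamma1 s) + mu (gamma2 t)).
  rewrite /Sigma -exprVn -exprMn sqrtr_sqr ger0_norm //.
  by rewrite mulr_ge0 ?enorm_ge0 // invr_ge0 addr_ge0 // ltW.
apply: ge_inf; last by exists (gamma1 s), (gamma2 t).
exists 0 => _ [x [y [[_ [g1 [g2 [l1 [l2 [s' [t' [p1 p2 <- <- _]]]]]]]] ->]]].
have n1 := weight_gt0 mu_gt0 p1 s'; have n2 := weight_gt0 mu_gt0 p2 t'.
by rewrite mulr_ge0 ?enorm_ge0 // invr_ge0 addr_ge0 // ltW.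
Qed.

End Sigma.

(** Stewart's formula for the point that divides the segment in the ratio of the
    radii.  As the left side is nonnegative, balls with radii proportional to [a]
    and [b] meet only if [c >= |x - y| ^ 2 / (a + b) ^ 2]. *)
Lemma ball_intersection (R : realType) (n : nat) (p x y : 'rV[R]_n) (a b c : R) :
  0 < a -> 0 < b -> dot (p - x) (p - x) <= c * a ^+ 2 ->
  dot (p - y) (p - y) <= c * b ^+ 2 ->
  dot (p - ((1 - a / (a + b)) *: x + (a / (a + b)) *: y))
      (p - ((1 - a / (a + b)) *: x + (a / (a + b)) *: y)) <=
  a * b * (c - dot (x - y) (x - y) / (a + b) ^+ 2).
Proof.
move=> a0 b0 hx hy; rewrite dot_barycenter.
have ab0 : 0 < a + b by rewrite addr_gt0.
have e : 1 - a / (a + b) = b / (a + b) by field; rewrite gt_eqF.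
rewrite e; set D := dot (x - y) _.
have h1 : b / (a + b) * dot (p - x) (p - x) <= b / (a + b) * (c * a ^+ 2).
  by rewrite ler_wpM2l // divr_ge0 // ltW.
have h2 : a / (a + b) * dot (p - y) (p - y) <= a / (a + b) * (c * b ^+ 2).
  by rewrite ler_wpM2l // divr_ge0 // ltW.
have -> : a * b * (c - D / (a + b) ^+ 2) = b / (a + b) * (c * a ^+ 2)
  + a / (a + b) * (c * b ^+ 2) - a / (a + b) * (b / (a + b)) * D.
  by field; rewrite gt_eqF.
by rewrite lerD2r lerD.
Qed.

(** * Joining two points close to a given one *)

Section Connect.
Variables (R : realType) (n : nat) (K : set 'rV[R]_n) (mu : 'rV[R]_n -> R).
Hypothesis mu_gt0 : forall q : 'rV[R]_n, K q -> 0 < mu q.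
Hypothesis mu_C3 : class_C_on 3 K mu.
Variables (gamma : R -> 'rV[R]_n) (L : R).
Hypothesis param : component_param K gamma L.

Let m : R -> R := mu \o gamma.
Let F : 'rV[R]_n -> R -> R := wdist2 gamma m.
Let m_gt0 s : 0 < m s. Proof. exact: weight_gt0 param s. Qed.
Let m_neq0 s : m s != 0. Proof. by rewrite gt_eqF. Qed.
Let cgamma : continuous gamma. Proof. exact: curve_continuous param.1. Qed.
Let cm : continuous m.
Proof. by move=> s; exact: is_derive_cont (weight_d0 mu_C3 param s). Qed.

Lemma wdist2_continuous (T : topologicalType) (P : T -> 'rV[R]_n) (S : T -> R) x :
  {for x, continuous P} -> {for x, continuous S} ->
  {for x, continuous (fun y => F (P y) (S y))}.
Proof.
move=> cP cS.
have cgS : {for x, continuous (fun y => gamma (S y))}.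
  by apply: (continuous_comp cS); exact: cgamma.
have cmS : {for x, continuous (fun y => m (S y))} by exact: cont_comp cm cS.
have cu : {for x, continuous (fun y => P y - gamma (S y))}.
  by apply: continuousB.
apply: cont_div; [by rewrite expf_neq0| exact: dot_continuous | exact: (cont_mul cmS cmS)].
Qed.

Definition midpoint (s t : R) : 'rV[R]_n :=
  (1 - m s / (m s + m t)) *: gamma s + (m s / (m s + m t)) *: gamma t.

Lemma midpoint_l s t : F (midpoint s t) s = Sigma mu (gamma s) (gamma t).
Proof.
have [a0 b0] := (m_gt0 s, m_gt0 t).
rewrite /F /wdist2 /Sigma enorm_sqr -[mu (gamma s)]/(m s) -[mu (gamma t)]/(m t).
have -> : midpoint s t - gamma s = - (m s / (m s + m t)) *: (gamma s - gamma t).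
  by apply/rowP => i; rewrite !mxE; field; rewrite gt_eqF // addr_gt0.
rewrite !(dotZl, dotZr); field; rewrite m_neq0 gt_eqF //= addr_gt0 //.
Qed.

Lemma midpoint_r s t : F (midpoint s t) t = Sigma mu (gamma s) (gamma t).
Proof.
have [a0 b0] := (m_gt0 s, m_gt0 t).
rewrite /F /wdist2 /Sigma enorm_sqr -[mu (gamma s)]/(m s) -[mu (gamma t)]/(m t).
have -> : midpoint s t - gamma t = (m t / (m s + m t)) *: (gamma s - gamma t).
  by apply/rowP => i; rewrite !mxE; field; rewrite gt_eqF // addr_gt0.
rewrite !(dotZl, dotZr); field; rewrite m_neq0 gt_eqF //= addr_gt0 //.
Qed.

Let G (y : R * R * 'rV[R]_n) : R := Num.max (F y.2 y.1.1) (F y.2 y.1.2).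

Lemma wdist2_le p s c : F p s <= c -> dot (p - gamma s) (p - gamma s) <= c * m s ^+ 2.
Proof. by rewrite /F /wdist2 ler_pdivrMr // exprn_gt0. Qed.

(** Moving [p] towards the weighted midpoint decreases the larger of the two
    distances, so at a local minimum [p] is that midpoint.  The midpoint depends
    continuously on the pair, so the pair is a local minimum of [Sigma]. *)
Lemma pair_local_min s t p : (\forall y \near (s, t, p), G (s, t, p) <= G y) ->
  G (s, t, p) = Sigma mu (gamma s) (gamma t) /\
  \forall x \near (s, t), Sigma mu (gamma s) (gamma t) <= Sigma mu (gamma x.1) (gamma x.2).
Proof.
set c := G (s, t, p) => Gmin; set P := midpoint s t; set Sg := Sigma _ _ _.
have hs : F p s <= c by rewrite /c /G le_max lexx.
have ht : F p t <= c by rewrite /c /G le_max lexx orbT.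
have [a0 b0] := (m_gt0 s, m_gt0 t).
have := ball_intersection a0 b0 (wdist2_le hs) (wdist2_le ht).
rewrite -/(midpoint s t) -/P.
have -> : dot (gamma s - gamma t) (gamma s - gamma t) / (m s + m t) ^+ 2 = Sg.
  by rewrite /Sg /Sigma enorm_sqr.
move=> hP; have Sle : Sg <= c.
  have : 0 <= m s * m t * (c - Sg) by apply: le_trans hP; exact: dot_ge0.
  by rewrite pmulr_rge0 ?mulr_gt0 // subr_ge0.
have seg tau x : 0 <= tau <= 1 -> F p x <= c -> F P x = Sg ->
    F ((1 - tau) *: p + tau *: P) x <= (1 - tau) * c + tau * Sg.
  move=> tau1 hx Px; rewrite {1}/F /wdist2 ler_pdivrMr ?exprn_gt0 //.
  have h1 := wdist2_le hx.
  have h2 : dot (gamma x - P) (gamma x - P) = Sg * m x ^+ 2.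
    by rewrite dot_subC -Px /F /wdist2 divfK // expf_neq0.
  rewrite dot_subC dot_barycenter h2 (dot_subC (gamma x) p).
  have h3 : 0 <= tau * (1 - tau) * dot (p - P) (p - P).
    by rewrite mulr_ge0 ?dot_ge0 // mulr_ge0; lra.
  have h4 : (1 - tau) * dot (p - gamma x) (p - gamma x) <= (1 - tau) * (c * m x ^+ 2).
    by rewrite ler_wpM2l //; lra.
  by lra.
have cS : c = Sg.
  apply/eqP; rewrite eq_le Sle andbT leNgt; apply/negP => Slt.
  have cy : {for 0, continuous (fun tau : R => (s, t, (1 - tau) *: p + tau *: P))}.
    apply: cont_pair; first exact: cst_continuous.
    have ci : {for (0 : R), continuous (fun tau : R => tau)} by exact: cvg_id.
    apply: cont_lincomb => //; try exact: cst_continuous.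
    by apply: continuousB => //; exact: cst_continuous.
  have /near_ball[d d0 hd] : \forall tau \near (0 : R),
      c <= G (s, t, (1 - tau) *: p + tau *: P).
    have Gm0 : nbhs (s, t, (1 - 0) *: p + 0 *: P) (fun y => c <= G y).
      by rewrite subr0 scale1r scale0r addr0.
    exact: (cy _ Gm0).
  pose tau := Num.min (d / 2) 1.
  have tau0 : 0 < tau by rewrite lt_min divr_gt0 // ltr01.
  have tau1 : 0 <= tau <= 1 by rewrite ltW //= ge_min lexx orbT.
  have taud : `|tau - 0| < d.
    rewrite subr0 gtr0_norm //; apply: (@le_lt_trans _ _ (d / 2)); last lra.
    by rewrite ge_min lexx.
  have := hd _ taud; rewrite leNgt => /negP; apply.
  have hlt : (1 - tau) * c + tau * Sg < c by nra.
  rewrite /G /= gt_max; apply/andP; split; apply: le_lt_trans hlt; apply: seg => //.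
    exact: midpoint_l.
  exact: midpoint_r.
split => //; rewrite cS subrr mulr0 in hP.
have pP : p = P.
  by apply/eqP; rewrite -subr_eq0; apply/eqP/dot_eq0/eqP; rewrite eq_le hP dot_ge0.
have cy : {for (s, t), continuous (fun x : R * R => (x.1, x.2, midpoint x.1 x.2))}.
  have c1 : {for (s, t), continuous (fun x : R * R => x.1)} by exact: cvg_fst.
  have c2 : {for (s, t), continuous (fun x : R * R => x.2)} by exact: cvg_snd.
  apply: cont_pair; first exact: cont_pair.
  have cm1 := cont_comp cm c1; have cm2 := cont_comp cm c2.
  have cq : {for (s, t), continuous (fun x : R * R => m x.1 / (m x.1 + m x.2))}.
    apply: cont_div => //; last exact: cont_add.
    by rewrite gt_eqF // addr_gt0.
  apply: cont_lincomb => //.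
  - by apply: continuousB => //; exact: cst_continuous.
  - by apply: (continuous_comp c1); exact: cgamma.
  - by apply: (continuous_comp c2); exact: cgamma.
have Gmid : \forall x \near (s, t), c <= G (x.1, x.2, midpoint x.1 x.2).
  have Gm0 : nbhs (s, t, midpoint s t) (fun y => c <= G y) by rewrite -/P -pP.
  exact: (cy _ Gm0).
apply: filterS Gmid => x; rewrite /G /= midpoint_l midpoint_r maxxx cS.
by [].
Qed.

End Connect.

Section Closedness.
Variables (R : realType) (X A B : topologicalType).

Lemma fst_cont (f : X -> A * B) : continuous f -> continuous (fun x => (f x).1).
Proof.
by move=> cf x; apply: (continuous_comp (cf x) (g := fst)); exact: cvg_fst.
Qed.

Lemma snd_cont (f : X -> A * B) : continuous f -> continuous (fun x => (f x).2).
Proof.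
by move=> cf x; apply: (continuous_comp (cf x) (g := snd)); exact: cvg_snd.
Qed.

Lemma closed_le_fun (f g : X -> R) :
  continuous f -> continuous g -> closed [set x | f x <= g x].
Proof.
move=> cf cg; have -> : [set x | f x <= g x] = (fun x => g x - f x) @^-1` [set y | 0 <= y].
  by apply/seteqP; split => x /=; rewrite subr_ge0.
apply: (proj1 (continuous_closedP _) _ _ (@closed_ge _ 0)) => x.
by apply: continuousB; [exact: cg | exact: cf].
Qed.

Lemma compact_cut (C : set X) (f g : X -> R) : compact C ->
  continuous f -> continuous g -> compact (C `&` [set x | f x <= g x]).
Proof. by move=> cC cf cg; apply: compact_closedI => //; exact: closed_le_fun. Qed.

End Closedness.

Section Arcs.
Variables (R : realType) (n : nat) (K : set 'rV[R]_n) (mu : 'rV[R]_n -> R).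
Hypothesis mu_gt0 : forall q : 'rV[R]_n, K q -> 0 < mu q.
Hypothesis mu_C3 : class_C_on 3 K mu.
Variables (gamma : R -> 'rV[R]_n) (L : R).
Hypothesis param : component_param K gamma L.

Let m : R -> R := mu \o gamma.
Let F : 'rV[R]_n -> R -> R := wdist2 gamma m.
Let L_gt0 : 0 < L. Proof. by case: param.1. Qed.
Let m_gt0 s : 0 < m s. Proof. exact: weight_gt0 param s. Qed.
Let m_neq0 s : m s != 0. Proof. by rewrite gt_eqF. Qed.

Lemma wdist2_periodic p s : F p (s + L) = F p s.
Proof.
have eg : gamma (s + L) = gamma s := curve_periodic param.1 0 s.
have em : m (s + L) = m s := weight_periodic mu param s.
by rewrite /F /wdist2 eg em.
Qed.

Lemma sublevel_critical_local_min p s : F p s * focal_bound mu gamma < 1 ->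
  wslope gamma (gamma^`()%classic) m (m^`()%classic) p s = 0 ->
  \forall t \near s, F p s <= F p t.
Proof.
move=> FM h0; apply: (critical_local_min (curve_d0 param) (curve_d1 param)
  (accel_cont param) (weight_d0 mu_C3 param) (weight_d1 mu_C3 param)
  (weight2_cont mu_C3 param) (curve_unit param.1) m_gt0
  (focal_le_bound mu_C3 param) FM h0).
Qed.

Lemma wdist2_derive p (s : R) : is_derive s 1 (F p)
  (wslope gamma (gamma^`()%classic) m (m^`()%classic) p s / m s ^+ 2).
Proof.
exact: (is_derive_wdist2 (curve_d0 param) (weight_d0 mu_C3 param) m_gt0 p s).
Qed.

Lemma sublevel_local_min p s V : V * focal_bound mu gamma < 1 -> F p s < V ->
  wslope gamma (gamma^`()%classic) m (m^`()%classic) p s / m s ^+ 2 = 0 ->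
  \forall t \near s, F p s <= F p t.
Proof.
move=> VM FV /eqP; rewrite mulf_eq0 invr_eq0 expf_eq0 (negbTE (m_neq0 s)) orbF.
move=> /eqP; apply: sublevel_critical_local_min.
have [M0|M0] := leP 0 (focal_bound mu gamma).
  by apply: le_lt_trans VM; rewrite ler_wpM2r // ltW.
by apply: le_lt_trans ltr01; rewrite mulr_ge0_le0 ?wdist2_ge0 // ltW.
Qed.

Lemma sublevel_quasiconvex p a b V : V * focal_bound mu gamma < 1 ->
  (forall u, a <= u <= b -> F p u < V) ->
  forall u, a <= u <= b -> F p u <= Num.max (F p a) (F p b).
Proof.
move=> VM hV; apply: (quasiconvex_segment (wdist2_derive p)) => w /hV.
exact: sublevel_local_min.
Qed.

Let T := (R * R * R * R * 'rV[R]_n)%type.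
Let xs (x : T) : R := x.1.1.1.1.
Let xu (x : T) : R := x.1.1.1.2.
Let xt (x : T) : R := x.1.1.2.
Let xw (x : T) : R := x.1.2.
Let xp (x : T) : 'rV[R]_n := gamma (xs x) + x.2.

Let cid : continuous (fun x : T => x). Proof. by move=> x; exact: cvg_id. Qed.
Let cxs : continuous xs. Proof. exact: fst_cont (fst_cont (fst_cont (fst_cont cid))). Qed.
Let cxu : continuous xu. Proof. exact: snd_cont (fst_cont (fst_cont (fst_cont cid))). Qed.
Let cxt : continuous xt. Proof. exact: snd_cont (fst_cont (fst_cont cid)). Qed.
Let cxw : continuous xw. Proof. exact: snd_cont (fst_cont cid). Qed.
Let cxp : continuous xp.
Proof.
move=> x; apply: continuousD; last exact: (snd_cont cid (x := x)).
exact: (continuous_comp (cxs (x := x)) (curve_continuous param.1 (x := _))).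
Qed.
Let cF (f : T -> R) : continuous f -> continuous (fun x => F (xp x) (f x)).
Proof.
by move=> cf x; exact: (wdist2_continuous mu_gt0 mu_C3 param (cxp (x := x)) (cf x)).
Qed.
Let G (x : T) : R := Num.max (F (xp x) (xs x)) (F (xp x) (xt x)).
Let cG : continuous G.
Proof.
by move=> x; exact: (continuous_max (cF cxs (x := x)) (cF cxt (x := x))).
Qed.

(** Two parameters close to a point, and on each of the two arcs between them a
    parameter far from it.  The last coordinate is the point minus [gamma (xs x)]:
    it is bounded, and unchanged when the parameters move by a period. *)
Let bad (r V : R) (x : T) : Prop :=
  [/\ [/\ xs x <= xu x, xu x <= xt x, xt x <= xw x & xw x <= xs x + L],
      G x <= r ^+ 2, V <= F (xp x) (xu x) & V <= F (xp x) (xw x)].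

(** Up to translation by periods these configurations form a compact set. *)
Lemma bad_minimizer r V : (exists x, bad r V x) ->
  exists2 x, bad r V x & forall y, bad r V y -> G x <= G y.
Proof.
move=> [x0 bx0].
have [B hB] := periodic_bounded L_gt0 (f := m)
  (fun s => is_derive_cont (weight_d0 mu_C3 param s)) (weight_periodic mu param).
have {}hB s : m s <= B by apply: hB; exists s.
have B0 : 0 <= B by apply: le_trans (hB 0); exact: ltW.
pose I := `[0, 2 * L] : set R.
pose Q : set 'rV[R]_n := [set v | forall i, `[- (`|r| * B), `|r| * B] (v ord0 i)].
pose box : set T := (I `*` I `*` I `*` I) `*` Q.
have cI : compact I by exact: segment_compact.
have cbox : compact box.
  apply: compact_setX; first by do 3 (apply: compact_setX => //).
  apply: (@rV_compact R n (fun=> `[- (`|r| * B), `|r| * B])) => i.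
  exact: segment_compact.
pose Z : set T := box `&` [set x | xs x <= xu x] `&` [set x | xu x <= xt x]
  `&` [set x | xt x <= xw x] `&` [set x | xw x <= xs x + L]
  `&` [set x | G x <= r ^+ 2] `&` [set x | V <= F (xp x) (xu x)]
  `&` [set x | V <= F (xp x) (xw x)].
have cst (c : R) : continuous (fun _ : T => c) by move=> x; exact: cst_continuous.
have cZ : compact Z.
  have cL : continuous (fun x => xs x + L).
    by move=> x; exact: (continuousD (cxs (x := x)) (cst L x)).
  have z1 := compact_cut (compact_cut cbox cxs cxu) cxu cxt.
  have z2 := compact_cut (compact_cut z1 cxt cxw) cxw cL.
  have z3 := compact_cut z2 cG (cst (r ^+ 2)).
  exact: compact_cut (compact_cut z3 (cst V) (cF cxu)) (cst V) (cF cxw).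
pose sh (k : int) (x : T) : T :=
  (xs x + k%:~R * L, xu x + k%:~R * L, xt x + k%:~R * L, xw x + k%:~R * L, x.2).
have shF k x u : F (xp (sh k x)) (u + k%:~R * L) = F (xp x) u.
  rewrite /F /wdist2 /xp /sh /= (curve_periodic_int param.1).
  have mk : m (u + k%:~R * L) = m u := periodic_int (weight_periodic mu param) k u.
  by rewrite (curve_periodic_int param.1) mk.
have shG k x : G (sh k x) = G x by rewrite /G !shF.
have shZ x : bad r V x -> exists k, Z (sh k x).
  move=> [[h1 h2 h3 h4] hG hu hw].
  have [k hk] := reduce_period L_gt0 0 (xs x); exists k.
  have hq : Q x.2.
    move=> i; have Fs : F (xp x) (xs x) <= r ^+ 2.
      by apply: le_trans hG; rewrite le_max lexx.
    have h6 := coord_le_dot x.2 i; move: Fs.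
    rewrite /F /wdist2 /xp addrAC subrr add0r ler_pdivrMr ?exprn_gt0 // => h5.
    have : `|x.2 0 i| <= `|r| * B.
      rewrite -(ler_pXn2r (ltn0Sn 1)) ?nnegrE ?mulr_ge0 //.
      apply: le_trans h6 (le_trans h5 _); rewrite exprMn real_normK ?num_real //.
      by rewrite ler_wpM2l ?sqr_ge0 // ler_pXn2r ?nnegrE // ltW.
    by rewrite ler_norml /= in_itv.
  have inI u : 0 <= u <= 2 * L -> I u by rewrite /I /= in_itv.
  split; last by rewrite /= shF.
  split; last by rewrite /= shF.
  split; last by rewrite /= shG.
  split; last by rewrite /xw /xs /sh /=; lra.
  split; last by rewrite /xw /xt /sh /=; lra.
  split; last by rewrite /xu /xt /sh /=; lra.
  split; last by rewrite /xu /xs /sh /=; lra.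
  by split => //; split; [split; [split|]|]; apply: inI => /=; lra.
have [k0 Zk0] := shZ _ bx0.
have Z0 : Z !=set0 by exists (sh k0 x0).
have [c Zc cmin] := compact_EVT_min Z0 cZ (continuous_subspaceT cG).
move: Zc; rewrite inE => Zc; exists c.
  by case: Zc => [[[[[[[_ ?] ?] ?] ?] ?] ?] ?].
move=> y /shZ[k Zk]; rewrite -(shG k y); apply: cmin; rewrite inE.
exact: Zk.
Qed.

(** Otherwise take the configuration of [bad_minimizer].  By quasiconvexity both
    arcs keep a far parameter under small perturbations, so it is a local minimum
    of the larger distance, and [pair_local_min] yields a double critical pair
    below [half_DCSD]. *)
Lemma sublevel_arc r V p s t : r < half_DCSD K mu -> 0 <= r ->
  r ^+ 2 < V -> V * focal_bound mu gamma < 1 ->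
  s <= t <= s + L -> F p s <= r ^+ 2 -> F p t <= r ^+ 2 ->
  (forall u, s <= u <= t -> F p u < V) \/
  (forall u, t <= u <= s + L -> F p u < V).
Proof.
move=> rD r0 rV VM st Fs Ft; apply: contrapT => /not_orP[].
move=> /existsNP[u0 /not_implyP[su /negP]]; rewrite -leNgt => Vu.
move=> /existsNP[w0 /not_implyP[tw /negP]]; rewrite -leNgt => Vw.
have [|x bx xmin] := @bad_minimizer r V.
  exists (s, u0, t, w0, p - gamma s); rewrite /bad /G /xp /xs /xt /xu /xw /=.
  rewrite subrKC; split => //; last by rewrite ge_max Fs.
  by case/andP: su => ? ?; case/andP: tw => ? ?.
move: bx xmin => [[]].
rewrite /G; set s1 := xs x; set u := xu x; set t1 := xt x; set w := xw x.
set q := xp x => h1 h2 h3 h4 hG hu hw xmin.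
have {}Fs : F q s1 <= r ^+ 2 by apply: le_trans hG; rewrite le_max lexx.
have {}Ft : F q t1 <= r ^+ 2 by apply: le_trans hG; rewrite le_max lexx orbT.
have neq a b : F q a <= r ^+ 2 -> V <= F q b -> a <> b.
  by move=> ha hb e; move: (lt_le_trans rV hb); rewrite -e ltNge ha.
(* Near and far parameters differ, so perturbations preserve the cyclic order. *)
have lt1 : s1 < u by rewrite lt_neqAle h1 andbT; apply/eqP/neq.
have lt2 : u < t1 by rewrite lt_neqAle h2 andbT eq_sym; apply/eqP/neq.
have lt3 : t1 < w by rewrite lt_neqAle h3 andbT; apply/eqP/neq.
have lt4 : w < s1 + L by rewrite lt_neqAle h4 andbT eq_sym; apply/eqP/neq; rewrite ?wdist2_periodic.
have [] := @pair_local_min _ _ _ _ mu_gt0 mu_C3 _ _ param s1 t1 q.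
  have c1 : {for (s1, t1, q), continuous (fun y : R * R * 'rV[R]_n => y.1.1)}.
    exact: (fst_cont (fst_cont (fun y => @cvg_id _ (nbhs y))) (x := _)).
  have c2 : {for (s1, t1, q), continuous (fun y : R * R * 'rV[R]_n => y.1.2)}.
    exact: (snd_cont (fst_cont (fun y => @cvg_id _ (nbhs y))) (x := _)).
  have c3 : {for (s1, t1, q), continuous (fun y : R * R * 'rV[R]_n => y.2)}.
    exact: (snd_cont (fun y => @cvg_id _ (nbhs y)) (x := _)).
  have cFy (a : R) := wdist2_continuous mu_gt0 mu_C3 param c3 (@cont_const _ _ (s1, t1, q) a).
  have n1 := cont_near_lt c1 lt1.
  have n2 := cont_near_gt c2 lt2; have n3 := cont_near_lt c2 lt3.
  have n4 : \forall y \near (s1, t1, q), w - L < y.1.1.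
    by apply: cont_near_gt c1 _ => /=; lra.
  have n5 := cont_near_gt (cFy u) (lt_le_trans rV hu).
  have n6 := cont_near_gt (cFy w) (lt_le_trans rV hw).
  near=> y; rewrite leNgt; apply/negP => yG.
  have y1 : y.1.1 < u by near: y.
  have y2 : u < y.1.2 by near: y.
  have y3 : y.1.2 < w by near: y.
  have y4 : w - L < y.1.1 by near: y.
  have y5 : r ^+ 2 < F y.2 u by near: y.
  have y6 : r ^+ 2 < F y.2 w by near: y.
  (* A point beyond level [r ^ 2] on a segment with ends below it can only come
     with a point at level [V]. *)
  have peak a b c : a <= c <= b -> r ^+ 2 < F y.2 c ->
      Num.max (F y.2 a) (F y.2 b) <= r ^+ 2 ->
      exists2 c', a <= c' <= b & V <= F y.2 c'.
    move=> acb rc Fab; apply: contrapT => hn.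
    have := @sublevel_quasiconvex y.2 a b V VM _ c acb; rewrite leNgt => /(_ _)/negP.
    apply; last exact: le_lt_trans rc.
    by move=> z zab; rewrite ltNge; apply/negP => hz; apply: hn; exists z.
  have hmax : Num.max (F y.2 y.1.1) (F y.2 y.1.2) <= r ^+ 2.
    by apply: le_trans (ltW yG) _; rewrite ge_max Fs.
  have hmax' : Num.max (F y.2 y.1.2) (F y.2 (y.1.1 + L)) <= r ^+ 2.
    by rewrite wdist2_periodic maxC.
  have [|u' /andP[u1 u2] Vu'] := peak y.1.1 y.1.2 u _ y5 hmax; first by rewrite !ltW.
  have [|w' /andP[w1 w2] Vw'] := peak y.1.2 (y.1.1 + L) w _ y6 hmax'.
    by rewrite ltW //=; lra.
  have := xmin (y.1.1, u', y.1.2, w', y.2 - gamma y.1.1).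
  rewrite /bad /G /xp /xs /xt /xu /xw /= subrKC => hx.
  by move: yG; rewrite ltNge hx.
rewrite -/F -/m => cE smin.
have DE : half_DCSD K mu <= Num.sqrt (Sigma mu (gamma s1) (gamma t1)).
  apply: (Sigma_local_min_ge mu_gt0 mu_C3 param param) => //.
  move=> /(curve_inj_lt param.1 (a := s1)) e.
  have : s1 = t1 by apply: e; lra.
  lra.
have : Num.sqrt (Sigma mu (gamma s1) (gamma t1)) <= r.
  rewrite -[leRHS](ger0_norm r0) -sqrtr_sqr ler_sqrt ?sqr_ge0 //.
  by rewrite -cE /= ge_max Fs.
by rewrite leNgt => /negP; apply; exact: lt_le_trans DE.
Unshelve. all: by end_near.
Qed.

End Arcs.

(** * Separation of components and collapsing arcs *)

Section Separation.
Variables (R : realType) (n : nat) (K : set 'rV[R]_n) (mu : 'rV[R]_n -> R).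
Hypothesis hK : union_of_closed_curves K.
Hypothesis mu_gt0 : forall q : 'rV[R]_n, K q -> 0 < mu q.
Hypothesis mu_C3 : class_C_on 3 K mu.

(** A minimum of [Sigma] over a product of two different components is a double
    critical pair. *)
Lemma close_same_component (p q1 q2 : 'rV[R]_n) (r : R) : K q1 -> K q2 ->
  0 <= r -> r < half_DCSD K mu ->
  dot (p - q1) (p - q1) <= r ^+ 2 * mu q1 ^+ 2 ->
  dot (p - q2) (p - q2) <= r ^+ 2 * mu q2 ^+ 2 ->
  connected_component K q1 = connected_component K q2.
Proof.
move=> Kq1 Kq2 r0 rD h1 h2; apply: contrapT => neq.
have [g1 [L1 [s1 [p1 e1 r1]]]] := component_param_exists hK Kq1.
have [g2 [L2 [s2 [p2 e2 r2]]]] := component_param_exists hK Kq2.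
have [L10 L20] : 0 < L1 /\ 0 < L2 by split; [case: p1.1|case: p2.1].
have neqg s t : g1 s <> g2 t.
  by move=> e; apply: neq; rewrite -r1 -r2 (param_range s p1) (param_range t p2) e.
pose S (x : R * R) := Sigma mu (g1 x.1) (g2 x.2).
have cS : continuous S.
  move=> x; have h := Sigma_differentiable mu_gt0 mu_C3 p1 p2 x.
  exact: differentiable_continuous h.
have cB : compact (`[0, L1] `*` `[0, L2] : set (R * R)).
  by apply: compact_setX; exact: segment_compact.
have B0 : (`[0, L1] `*` `[0, L2] : set (R * R)) !=set0.
  by exists (0, 0); split; rewrite /= in_itv /= lexx ltW.
have [[c1 c2] _ cmin] := compact_EVT_min B0 cB (continuous_subspaceT cS).
have {}cmin x : S (c1, c2) <= S x.
  have [k1 hk1] := reduce_period L10 0 x.1; have [k2 hk2] := reduce_period L20 0 x.2.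
  have -> : S x = S (x.1 + k1%:~R * L1, x.2 + k2%:~R * L2).
    by rewrite /S /= (curve_periodic_int p1.1) (curve_periodic_int p2.1).
  by apply: cmin; rewrite inE; split; rewrite /= in_itv /=; lra.
have DS : half_DCSD K mu <= Num.sqrt (S (c1, c2)).
  apply: (Sigma_local_min_ge mu_gt0 mu_C3 p1 p2 (@neqg c1 c2)).
  by apply: filterE => x; exact: cmin.
have m1 := mu_gt0 Kq1; have m2 := mu_gt0 Kq2.
have Sr : S (s1, s2) <= r ^+ 2.
  have := le_trans (dot_ge0 _) (ball_intersection m1 m2 h1 h2).
  by rewrite pmulr_rge0 ?mulr_gt0 // subr_ge0 /S /= e1 e2 /Sigma enorm_sqr.
have : Num.sqrt (S (c1, c2)) <= r.
  rewrite -[leRHS](ger0_norm r0) -sqrtr_sqr ler_sqrt ?sqr_ge0 //.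
  exact: le_trans (cmin _) Sr.
by rewrite leNgt => /negP; apply; exact: lt_le_trans DS.
Qed.

End Separation.

Section Arc.
Variables (R : realType) (n : nat) (K : set 'rV[R]_n) (mu : 'rV[R]_n -> R).
Hypothesis mu_gt0 : forall q : 'rV[R]_n, K q -> 0 < mu q.
Hypothesis mu_C3 : class_C_on 3 K mu.
Variables (gamma : R -> 'rV[R]_n) (L : R).
Hypothesis param : component_param K gamma L.
Variables (p : 'rV[R]_n) (r : R).
Hypothesis r_gt0 : 0 < r.
Hypothesis rM : r ^+ 2 * focal_bound mu gamma < 1.

Let m : R -> R := mu \o gamma.
Let g1 : R -> 'rV[R]_n := gamma^`()%classic.
Let g2 : R -> 'rV[R]_n := gamma^`(2)%classic.
Let L_gt0 : 0 < L. Proof. by case: param.1. Qed.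
Let m_gt0 s : 0 < m s. Proof. exact: weight_gt0 param s. Qed.

Section ConstantArc.
Variables (J : set R) (x y : R).
Hypothesis iJ : is_interval J.
Hypotheses (Jx : J x) (Jy : J y) (xy : x <> y).
Hypothesis constJ : forall s, J s -> wdist2 gamma m p s = r ^+ 2.

Let d0 := curve_d0 param.
Let d1 := curve_d1 param.
Let d2 := curve_d2 param.
Let e0 := weight_d0 mu_C3 param.
Let e1 := weight_d1 mu_C3 param.
Let us := curve_unit param.1.
Let fl := focal_le_bound mu_C3 param.
Let sl := slope_le_bound mu_C3 param.

Lemma arc_normal_part s : J s ->
  2 *: normal_part gamma g1 p s = (r ^+ 2 * m s ^+ 2) *: g2 s.
Proof.
by move=> Js; have [] := collapse_flat d0 d1 e0 e1 us m_gt0 fl iJ Jx Jy xy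
  r_gt0 rM constJ Js.
Qed.

Lemma arc_weight2_lt0 s : J s -> (m^`(2))%classic s < 0.
Proof.
move=> Js.
rewrite (collapse_m2 d0 d1 e0 e1 us m_gt0 fl iJ Jx Jy xy r_gt0 rM constJ Js).
have := collapse_accel_gt0 d0 d1 e0 e1 us m_gt0 fl sl iJ Jx Jy xy r_gt0 rM constJ Js.
by move=> h; rewrite oppr_lt0 divr_gt0 // mulr_gt0.
Qed.

Lemma arc_expmu s : J s -> expmu K mu (gamma s) (r *: principal_normal gamma s) = p.
Proof.
move=> Js; apply: (expmu_collapse mu_gt0 mu_C3 param r_gt0).
- exact: (collapse_position d0 d1 e0 e1 us m_gt0 fl iJ Jx Jy xy r_gt0 rM constJ Js).
- exact: (collapse_energy d0 d1 e0 e1 us m_gt0 fl iJ Jx Jy xy r_gt0 rM constJ Js).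
- exact: (collapse_accel_gt0 d0 d1 e0 e1 us m_gt0 fl sl iJ Jx Jy xy r_gt0 rM constJ Js).
Qed.

Lemma arc_structure : exists2 kappa : R, 0 < kappa &
  0 < r /\
  (forall s : R, J s -> curvature gamma s = kappa) /\
  (forall s : R, J s ->
    (mu \o gamma)^`()%classic s ^+ 2
    - mu (gamma s) * (mu \o gamma)^`(2)%classic s = 1 / r ^+ 2) /\
  (forall s : R, J s ->
    gamma^`(3)%classic s + kappa ^+ 2 *: gamma^`()%classic s = 0) /\
  (exists a : R, forall s : R, J s ->
    mu (gamma s) = 2 / (kappa * r) * cos (kappa * s / 2 + a)) /\
  circular_arc gamma kappa J.
Proof.
have kpos := collapse_accel_gt0 d0 d1 e0 e1 us m_gt0 fl sl iJ Jx Jy xy r_gt0 rM constJ.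
have k0 : 0 < curvature gamma x by rewrite sqrtr_gt0 kpos.
have hk s : J s -> dot (g2 s) (g2 s) = curvature gamma x ^+ 2.
  move=> Js; rewrite curvature_sqr.
  exact: (collapse_accel_const d0 d1 d2 e0 e1 us m_gt0 fl iJ Jx Jy xy r_gt0 rM constJ).
exists (curvature gamma x); first exact: k0.
split; first exact: r_gt0.
split.
  have cge u : 0 <= curvature gamma u by exact: enorm_ge0.
  move=> s Js; apply/eqP; rewrite -(@eqrXn2 _ 2 _ _ isT (cge s) (cge x)).
  by apply/eqP; rewrite [LHS]curvature_sqr; exact: hk.
split.
  move=> s Js.
  exact: (collapse_wronskian d0 d1 e0 e1 us m_gt0 fl iJ Jx Jy xy r_gt0 rM constJ Js).
split.
  move=> s Js; rewrite -(hk s Js).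
  exact: (collapse_jerk d0 d1 d2 e0 e1 us m_gt0 fl iJ Jx Jy xy r_gt0 rM constJ Js).
split.
  exact: (collapse_cos d0 d1 e0 e1 us m_gt0 fl iJ Jx Jy xy r_gt0 rM constJ k0 hk).
exact: (collapse_circle d0 d1 d2 e0 e1 us m_gt0 fl iJ Jx Jy xy r_gt0 rM constJ k0 hk).
Qed.

(** On [J] the weight is strictly concave, while on the whole closed curve its
    derivative has a critical point by Rolle's theorem. *)
Lemma arc_not_full : gamma @` J <> range gamma.
Proof.
move=> JK; pose m1 : R -> R := (m^`())%classic.
have m1L : m1 0 = m1 L.
  by rewrite -[L]add0r; exact/esym/(weight1_periodic mu_C3 param).
have dm1 t : t \in `]0, L[%R -> derivable m1 t 1 by case: (e1 t).
have cm1 : {within `[0, L], continuous m1}.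
  by apply: continuous_subspaceT => t; exact: is_derive_cont (e1 t).
have [c _ dc] := Rolle L_gt0 dm1 cm1 m1L.
have c0 : (m^`(2))%classic c = 0 by exact: is_derive_uniq (e1 c) dc.
have [j Jj jc] : (gamma @` J) (gamma c) by rewrite JK; exists c.
have [k ck] := curve_inj param.1 jc.
have := arc_weight2_lt0 Jj.
have -> : (m^`(2))%classic j = (m^`(2))%classic c.
  by rewrite ck; apply/esym; exact: periodic_int (weight2_periodic mu_C3 param) k j.
by rewrite c0 ltxx.
Qed.

End ConstantArc.

(** The principal normal is a unit normal vector, so [expmu_critical] applies. *)
Lemma collapses_constant (J : set R) s :
  collapses_on K mu gamma r p J -> J s -> wdist2 gamma m p s = r ^+ 2.
Proof.
move=> cJ /cJ[k0 e].
have N1 : enorm (principal_normal gamma s) = 1.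
  rewrite /principal_normal /enorm !(dotZl, dotZr) -curvature_sqr mulrA -expr2.
  by rewrite -exprMn mulVf ?gt_eqF // expr1n sqrtr1.
have Ng : dot (principal_normal gamma s) (gamma^`()%classic s) = 0.
  rewrite /principal_normal dotZl dotC.
  by rewrite (velocity_accel (curve_d1 param) (curve_unit param.1)) mulr0.
by have [] := expmu_critical mu_gt0 mu_C3 param (ltW r_gt0) rM N1 Ng e.
Qed.

(** Both [v] and [g2 s] are positive multiples of the normal part of
    [p - gamma s]. *)
Lemma arc_principal_normal s v :
  2 *: normal_part gamma g1 p s = (r ^+ 2 * m s ^+ 2) *: g2 s ->
  enorm v = 1 -> dot v (g1 s) = 0 -> expmu K mu (gamma s) (r *: v) = p ->
  v = principal_normal gamma s.
Proof.
move=> h v1 vg e.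
have [_ _ hn] := expmu_critical mu_gt0 mu_C3 param (ltW r_gt0) rM v1 vg e.
move: h; rewrite hn; set c := Num.sqrt _ => h.
have c0 : 0 < c.
  rewrite sqrtr_gt0 subr_gt0; apply: le_lt_trans rM.
  by rewrite ler_wpM2l ?sqr_ge0 // (slope_le_bound mu_C3 param).
have ms := m_gt0 s; have rm : 0 < r * m s by rewrite mulr_gt0.
apply: (@principal_normal_unit _ _ _ _ _ (2 * c / (r * m s))) => //.
  by rewrite divr_gt0 // mulr_gt0.
apply: (@scalerI _ _ (r ^+ 2 * m s ^+ 2)).
  by rewrite mulf_neq0 // expf_neq0 // gt_eqF.
rewrite -/g2 -h !scalerA; congr (_ *: _); rewrite -/m; field.
by rewrite !gt_eqF.
Qed.

End Arc.

(** * Horizontal collapsing *)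

Section ArcExistence.
Variables (R : realType) (n : nat) (K : set 'rV[R]_n) (mu : 'rV[R]_n -> R).
Hypothesis mu_gt0 : forall q : 'rV[R]_n, K q -> 0 < mu q.
Hypothesis mu_C3 : class_C_on 3 K mu.
Variables (gamma : R -> 'rV[R]_n) (L : R).
Hypothesis param : component_param K gamma L.

Let m : R -> R := mu \o gamma.
Let m_gt0 s : 0 < m s. Proof. exact: weight_gt0 param s. Qed.

Lemma sublevel_constant (p : 'rV[R]_n) (V a b : R) :
  V * focal_bound mu gamma < 1 ->
  (forall u, a <= u <= b -> wdist2 gamma m p u < V) ->
  wslope gamma (gamma^`()%classic) m (m^`()%classic) p a = 0 ->
  wslope gamma (gamma^`()%classic) m (m^`()%classic) p b = 0 ->
  forall u, a <= u <= b -> wdist2 gamma m p u = wdist2 gamma m p a.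
Proof.
move=> VM hV ha hb.
apply: (critical_ends_constant (wdist2_derive mu_gt0 mu_C3 param p)).
- by rewrite ha mul0r.
- by rewrite hb mul0r.
- move=> w /hV; exact: (sublevel_local_min mu_gt0 mu_C3 param VM).
Qed.

Lemma focal_bound_ge0 : 0 <= focal_bound mu gamma.
Proof. by apply: le_trans (slope_le_bound mu_C3 param 0); exact: sqr_ge0. Qed.

Lemma level_above (c : R) : 0 <= c -> c * focal_bound mu gamma < 1 ->
  exists2 V, c < V & V * focal_bound mu gamma < 1.
Proof.
have M0 := focal_bound_ge0; set M := focal_bound mu gamma in M0 *.
move=> c0 cM; have M1 : 0 < 2 * (M + 1) by lra.
exists (c + (1 - c * M) / (2 * (M + 1))).
  by rewrite ltrDl divr_gt0 // subr_gt0.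
have -> : (c + (1 - c * M) / (2 * (M + 1))) * M
   = 1 - (1 - c * M) * ((M + 2) / (2 * (M + 1))) by field; rewrite gt_eqF //; lra.
by rewrite ltrBlDr ltrDl mulr_gt0 ?subr_gt0 // divr_gt0 //; lra.
Qed.

End ArcExistence.

Lemma UR_lt (R : realType) (n : nat) (K : set 'rV[R]_n) (mu : 'rV[R]_n -> R) (r : R) :
  r < UR K mu -> r < half_DCSD K mu /\ r < FocRad K mu.
Proof. by rewrite lt_min => /andP. Qed.

(* The hypotheses are symmetric in the two indices, so the case s2 < s1 is the
   instance with the two indices interchanged. *)
Theorem theorem2 (R : realType) (n : nat) (K : set 'rV[R]_n)
    (mu : 'rV[R]_n -> R)
    (hK : union_of_closed_curves K)
    (mu_gt0 : forall q : 'rV[R]_n, K q -> 0 < mu q)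
    (mu_C3 : class_C_on 3 K mu)
    (q1 q2 v1 v2 p0 : 'rV[R]_n) (r1 r2 : R)
    (Kq1 : K q1) (Kq2 : K q2)
    (r1_ge0 : 0 <= r1) (r1_lt : r1 < UR K mu)
    (r2_ge0 : 0 <= r2) (r2_lt : r2 < UR K mu)
    (v1_unit : enorm v1 = 1) (v1_normal : normal_vector K q1 v1)
    (v2_unit : enorm v2 = 1) (v2_normal : normal_vector K q2 v2)
    (exp1 : expmu K mu q1 (r1 *: v1) = p0)
    (exp2 : expmu K mu q2 (r2 *: v2) = p0)
    (neq12 : (q1, r1 *: v1) <> (q2, r2 *: v2)) :
  connected_component K q1 = connected_component K q2 /\
  q1 <> q2 /\
  forall (gamma : R -> 'rV[R]_n) (L s1 s2 : R),
    closed_curve gamma L ->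
    range gamma = connected_component K q1 ->
    0 <= s1 -> s1 < s2 -> s2 < L ->
    gamma s1 = q1 -> gamma s2 = q2 ->
    r1 = r2 /\
    v1 = principal_normal gamma s1 /\
    v2 = principal_normal gamma s2 /\
    exists I : set R,
      (I = `[s1, s2] \/ I = `[s2 - L, s1]) /\
      (forall s : R, I s ->
         expmu K mu (gamma s) (r1 *: principal_normal gamma s) = p0) /\
      (exists2 kappa : R, 0 < kappa &
         0 < r1 /\
         (forall s : R, I s -> curvature gamma s = kappa) /\
         (forall s : R, I s ->
            (mu \o gamma)^`()%classic s ^+ 2
            - mu (gamma s) * (mu \o gamma)^`(2)%classic s
            = 1 / r1 ^+ 2) /\
         (forall s : R, I s ->
            gamma^`(3)%classic s + kappa ^+ 2 *: gamma^`()%classic s = 0) /\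
         (exists a : R, forall s : R, I s ->
            mu (gamma s) = 2 / (kappa * r1) * cos (kappa * s / 2 + a)) /\
         circular_arc gamma kappa I) /\
      gamma @` I <> connected_component K q1 /\
      (forall J : set R,
         I `<=` J -> maximal_collapsing_interval K mu gamma r1 p0 J ->
         gamma @` J <> connected_component K q1).
Proof.
have dotn gamma L s v : component_param K gamma L -> normal_vector K (gamma s) v ->
    dot v (gamma^`()%classic s) = 0.
  by move=> param nv; exact: nv param erefl.
have [r1D r1F] := UR_lt r1_lt; have [r2D r2F] := UR_lt r2_lt.
pose r := Num.max r1 r2.
have r_ge0 : 0 <= r by rewrite le_max r1_ge0.
have rD : r < half_DCSD K mu by rewrite gt_max r1D.
have rF : r < FocRad K mu by rewrite gt_max r1F.
have r1r : r1 ^+ 2 <= r ^+ 2 by rewrite ler_pXn2r ?nnegrE // le_max lexx.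
have r2r : r2 ^+ 2 <= r ^+ 2 by rewrite ler_pXn2r ?nnegrE // le_max lexx orbT.
have crit gamma L s v ri (param : component_param K gamma L) (ri0 : 0 <= ri)
    (riF : ri < FocRad K mu) := @expmu_critical _ _ _ _ mu_gt0 mu_C3 _ _ param p0 v ri s
      ri0 (FocRad_lt mu_C3 param ri0 riF).
have dist q v ri : K q -> 0 <= ri -> ri < FocRad K mu -> enorm v = 1 ->
    normal_vector K q v -> expmu K mu q (ri *: v) = p0 ->
    dot (p0 - q) (p0 - q) = ri ^+ 2 * mu q ^+ 2.
  move=> Kq ri0 riF vu nv e.
  have [gamma [L [s [param sq _]]]] := component_param_exists hK Kq.
  rewrite -sq in nv e *.
  have [<- _ _] := crit _ _ _ _ _ param ri0 riF vu (dotn _ _ _ _ param nv) e.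
  by rewrite /wdist2 divfK // expf_neq0 // gt_eqF // (weight_gt0 mu_gt0 param).
have D1 := dist _ _ _ Kq1 r1_ge0 r1F v1_unit v1_normal exp1.
have D2 := dist _ _ _ Kq2 r2_ge0 r2F v2_unit v2_normal exp2.
have same : connected_component K q1 = connected_component K q2.
  apply: (close_same_component hK mu_gt0 mu_C3 (p := p0) (r := r)) => //.
    by rewrite D1 ler_wpM2r ?sqr_ge0.
  by rewrite D2 ler_wpM2r ?sqr_ge0.
(* Over a common base point, [p0] determines the radius by its weighted distance
   and the direction by its normal part. *)
have q12 : q1 <> q2.
  move=> q12; apply: neq12.
  have [gamma [L [s [param sq _]]]] := component_param_exists hK Kq1.
  have nv1 := v1_normal; have nv2 := v2_normal; have e1 := exp1; have e2 := exp2.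
  rewrite -q12 -sq in nv2 e2; rewrite -sq in nv1 e1.
  have [w1 _ n1] := crit _ _ _ _ _ param r1_ge0 r1F v1_unit (dotn _ _ _ _ param nv1) e1.
  have [w2 _ n2] := crit _ _ _ _ _ param r2_ge0 r2F v2_unit (dotn _ _ _ _ param nv2) e2.
  have r12 : r1 = r2.
    by apply/eqP; rewrite -(eqrXn2 (ltn0Sn 1)) // -w1 w2.
  congr (_, _) => //; move: n1; rewrite n2 -r12; set c := Num.sqrt _ => n1.
  have c0 : 0 < c.
    have rM := FocRad_lt mu_C3 param r1_ge0 r1F.
    rewrite sqrtr_gt0 subr_gt0; apply: le_lt_trans rM.
    by rewrite ler_wpM2l ?sqr_ge0 // (slope_le_bound mu_C3 param).
  have mc : (mu \o gamma) s * c != 0.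
    by rewrite mulf_neq0 // gt_eqF // (weight_gt0 mu_gt0 param).
  by apply: (scalerI mc); rewrite !scalerA n1.
split=> //; split=> // gamma L s1 s2 cg rg s1_ge0 s12 s2L gs1 gs2.
have param : component_param K gamma L by split => //; exists q1.
have rM := FocRad_lt mu_C3 param r_ge0 rF.
have r1M := FocRad_lt mu_C3 param r1_ge0 r1F.
have crit1 s : gamma s = q1 -> wdist2 gamma (mu \o gamma) p0 s = r1 ^+ 2 /\
    wslope gamma (gamma^`()%classic) (mu \o gamma) ((mu \o gamma)^`()%classic) p0 s = 0.
  move=> sq; have nv := v1_normal; have e := exp1; rewrite -sq in nv e.
  by have [] := crit _ _ _ _ _ param r1_ge0 r1F v1_unit (dotn _ _ _ _ param nv) e.
have crit2 s : gamma s = q2 -> wdist2 gamma (mu \o gamma) p0 s = r2 ^+ 2 /\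
    wslope gamma (gamma^`()%classic) (mu \o gamma) ((mu \o gamma)^`()%classic) p0 s = 0.
  move=> sq; have nv := v2_normal; have e := exp2; rewrite -sq in nv e.
  by have [] := crit _ _ _ _ _ param r2_ge0 r2F v2_unit (dotn _ _ _ _ param nv) e.
have per k s : (gamma^`(k))%classic (s - L) = (gamma^`(k))%classic s.
  by rewrite -[in RHS](subrK L s) (curve_periodic cg).
have gs2L : gamma (s2 - L) = q2 by rewrite -gs2; exact: (per 0).
have [V rV VM] := level_above mu_C3 param (sqr_ge0 r) rM.
(* The parameter [t] of [q2] on [I] is [s2] or [s2 - L]. *)
have [I [t [II [iI [Is1 [It [s1t [gt [pt Iconst]]]]]]]]] : exists (I : set R) (t : R),
    (I = `[s1, s2] \/ I = `[s2 - L, s1]) /\ is_interval I /\ I s1 /\ I t /\ s1 <> t /\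
    gamma t = q2 /\ principal_normal gamma t = principal_normal gamma s2 /\
    forall u, I u -> wdist2 gamma (mu \o gamma) p0 u = wdist2 gamma (mu \o gamma) p0 s1.
  have st : s1 <= s2 <= s1 + L by lra.
  have h1 : wdist2 gamma (mu \o gamma) p0 s1 <= r ^+ 2 by rewrite (crit1 _ gs1).1.
  have h2 : wdist2 gamma (mu \o gamma) p0 s2 <= r ^+ 2 by rewrite (crit2 _ gs2).1.
  have [hV|hV] := sublevel_arc mu_gt0 mu_C3 param rD r_ge0 rV VM st h1 h2.
  - exists `[s1, s2], s2; split; first by left.
    split; first exact: interval_is_interval.
    do 2 (split; first by rewrite /= in_itv /= lexx ltW).
    split; first by move=> e; rewrite e ltxx in s12.
    split; first exact: gs2.
    split; first by [].
    move=> u; rewrite /= in_itv /=.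
    exact: (sublevel_constant mu_gt0 mu_C3 param VM hV (crit1 _ gs1).2 (crit2 _ gs2).2).
  - exists `[s2 - L, s1], (s2 - L); split; first by right.
    split; first exact: interval_is_interval.
    do 2 (split; first by rewrite /= in_itv /= lexx; lra).
    split; first lra.
    split; first exact: gs2L.
    split.
      by rewrite /principal_normal /curvature !per.
    have hV' u : s2 - L <= u <= s1 -> wdist2 gamma (mu \o gamma) p0 u < V.
      by move=> hu; rewrite -(wdist2_periodic mu param); apply: hV; lra.
    have h := sublevel_constant mu_gt0 mu_C3 param VM hV' (crit2 _ gs2L).2 (crit1 _ gs1).2.
    by move=> u; rewrite /= in_itv /= => hu; rewrite (h u hu) (h s1) //; lra.
have Ir u : I u -> wdist2 gamma (mu \o gamma) p0 u = r1 ^+ 2.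
  by move=> Iu; rewrite (Iconst _ Iu) (crit1 _ gs1).1.
have r12 : r1 = r2.
  have e12 : r1 ^+ 2 = r2 ^+ 2 by rewrite -(Ir _ It) (crit2 _ gt).1.
  by apply/eqP; rewrite -(@eqrXn2 _ 2 _ _ isT r1_ge0 r2_ge0) e12.
have r1_gt0 : 0 < r1.
  rewrite lt0r r1_ge0 andbT; apply/eqP => r0; apply: q12.
  move: D1 D2; rewrite -r12 r0 expr0n !mul0r => /dot_eq0 /eqP.
  by rewrite subr_eq0 => /eqP <- /dot_eq0 /eqP; rewrite subr_eq0 => /eqP.
have npart := arc_normal_part mu_gt0 mu_C3 param r1_gt0 r1M iI Is1 It s1t Ir.
(* Any interval around [I] with constant weighted distance will do, which covers
   both [I] itself and the maximal ones. *)
have not_full J : is_interval J -> I `<=` J ->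
    (forall s, J s -> wdist2 gamma (mu \o gamma) p0 s = r1 ^+ 2) ->
    gamma @` J <> connected_component K q1.
  move=> iJ IJ Jr; rewrite -rg.
  exact: (arc_not_full mu_gt0 mu_C3 param r1_gt0 r1M iJ (IJ _ Is1) (IJ _ It) s1t Jr).
have nv1 : dot v1 (gamma^`()%classic s1) = 0 by apply: dotn param _; rewrite gs1.
have nv2 : dot v2 (gamma^`()%classic t) = 0 by apply: dotn param _; rewrite gt.
have e1 : expmu K mu (gamma s1) (r1 *: v1) = p0 by rewrite gs1.
have e2 : expmu K mu (gamma t) (r1 *: v2) = p0 by rewrite gt r12.
split; first exact: r12.
split.
  exact: (arc_principal_normal mu_gt0 mu_C3 param r1_gt0 r1M (npart _ Is1) v1_unit nv1 e1).
split.
  rewrite -pt.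
  exact: (arc_principal_normal mu_gt0 mu_C3 param r1_gt0 r1M (npart _ It) v2_unit nv2 e2).
exists I; split; first exact: II.
split.
  exact: (arc_expmu mu_gt0 mu_C3 param r1_gt0 r1M iI Is1 It s1t Ir).
split.
  exact: (arc_structure mu_gt0 mu_C3 param r1_gt0 r1M iI Is1 It s1t Ir).
split; first exact: (not_full I iI (@subset_refl _ I) Ir).
move=> J IJ [iJ cJ _]; apply: (not_full J iJ IJ) => s.
exact: (collapses_constant mu_gt0 mu_C3 param r1_gt0 r1M cJ).
Qed.
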